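(* Let $G$ and $H$ be finite simple $2$-connected cubic graphs. If the cycle matroids satisfy $M(G)\cong M(H)$, then $$\Gamma_G(x)=\Gamma_H(x).$$ Equivalently, the orientable genus polynomial of a finite simple $2$-connected cubic graph is invariant under balanced Whitney twists: if $G$ is a finite simple $2$-connected cubic graph and $G^{\tau}$ is obtained from $G$ by a balanced Whitney twist, then $\Gamma_G(x)=\Gamma_{G^{\tau}}(x)$.
   Context: A graph is $2$-connected if it is connected, has at least three vertices and has no cut vertex. Cubic means $3$-regular. Genus polynomial. A dart of $G$ is an ordered pair $(u,v)$ with $uv\in E(G)$. A rotation system $\rho$ of $G$ assigns to each vertex $v$ a cyclic ordering of its neighbours; $\sigma_v(u)$ denotes the neighbour of $v$ following $u$. The face permutation of $\rho$ on darts is $\phi_\rho(u,v)=(v,\sigma_v(u))$; its cycles are the faces of $\rho$, and $F(\rho)$ is their number. For a connected cubic graph on $n$ vertices there are $2^n$ rotation systems, and the genus of $\rho$ is given by Euler's formula, $g(\rho)=1+\frac n4-\frac12F(\rho)$. The orientable genus polynomial is $\Gamma_G(x)=\sum_\rho x^{g(\rho)}$, the sum over all rotation systems of $G$. Cycle matroid. $M(G)$ has ground set $E(G)$ and its circuits are the edge sets of the cycles of $G$. Whitney twist. Let $G$ be $2$-connected. A Whitney separation is an edge partition $E(G)=E(A)\sqcup E(B)$ into edge-disjoint subgraphs $A,B$ with $V(A)\cap V(B)=\{u,v\}$, each of $A,B$ containing a $u$--$v$ path. Treating the cut vertices as separate copies $u_A,v_A$ in $A$ and $u_B,v_B$ in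 $B$, $G$ is the gluing $u_A=u_B$, $v_A=v_B$; the Whitney twist $G^{\tau}$ is the gluing $u_A=v_B$, $v_A=u_B$. The twist is balanced if $G^{\tau}$ has the same degrees at $u$ and $v$ as $G$, equivalently (for cubic $G$) $\deg_A(u)=\deg_A(v)$. *)

(* Defs.v *)
From HB Require Import structures.
From mathcomp Require Import all_boot all_order all_algebra all_fingroup.

Set Implicit Arguments.
Unset Strict Implicit.
Unset Printing Implicit Defensive.

Import GRing.Theory Num.Theory.

Record sgraph := SGraph {
  svertex :> finType;
  sedge : rel svertex;
  sedge_sym : symmetric sedge;
  sedge_irrefl : irreflexive sedge }.

Section Graph.
Variable G : sgraph.

Definition nbrs (x : G) : {set G} := [set y | sedge x y].

Definition deg (x : G) : nat := #|nbrs x|.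

Definition cubic : Prop := forall x : G, deg x = 3.

Definition connected : Prop := forall x y : G, connect (@sedge G) x y.

Definition del_edge (z : G) : rel G :=
  [rel x y | [&& x != z, y != z & sedge x y]].

Definition cut_vertex (z : G) : Prop :=
  exists x y : G, [/\ x != z, y != z, connect (@sedge G) x y
                    & ~~ connect (del_edge z) x y].

Definition two_connected : Prop :=
  [/\ connected, 3 <= #|G| & forall z : G, ~ cut_vertex z].

(* An edge is the two-element set of its ends. *)
Definition edge_set : {set {set G}} :=
  [set [set p.1; p.2] | p : G * G & sedge p.1 p.2].

Definition edge : finType := {e : {set G} | e \in edge_set}.

(* A cycle is a cyclic sequence of at least three distinct, consecutively
   adjacent vertices; [C] is a circuit of the cycle matroid M(G) when it is
   the edge set of such a cycle. *)
Definition circuit (C : {set edge}) : Prop :=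
  exists c : seq G, [/\ 2 < size c, ucycle (@sedge G) c
    & [set val e | e in C] = [set [set x; next c x] | x in c]].

(* A cyclic ordering of N(v) is encoded by its successor permutation: a
   permutation of the vertices fixing everything outside N(v) and having N(v)
   as a single cycle. This encoding is one-to-one. *)
Definition is_rotation (rho : {ffun G -> {perm G}}) : bool :=
  [forall v, perm_on (nbrs v) (rho v) &&
             [forall u in nbrs v, porbit (rho v) u == nbrs v]].

Definition rotation : finType := {rho : {ffun G -> {perm G}} | is_rotation rho}.

Definition dart : finType := {d : G * G | sedge d.1 d.2}.

Lemma face_subproof (rho : rotation) (d : dart) :
  sedge (val d).2 (val rho (val d).2 (val d).1).
Proof.
case: rho d => rho /= /forallP rhoP [[u v] /= uv].
have /andP[rho_on _] := rhoP v.
by have := perm_closed u rho_on; rewrite !inE (sedge_sym v u) uv.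
Qed.

Definition face_fun (rho : rotation) (d : dart) : dart :=
  exist (fun d : G * G => sedge d.1 d.2)
    ((val d).2, val rho (val d).2 (val d).1) (face_subproof rho d).

Lemma face_fun_inj (rho : rotation) : injective (face_fun rho).
Proof.
move=> d d' /(congr1 val)/= [eq_v]; rewrite -eq_v => /perm_inj eq_u.
by apply: val_inj; rewrite [val d]surjective_pairing eq_u eq_v -surjective_pairing.
Qed.

Definition face_perm (rho : rotation) : {perm dart} := perm (@face_fun_inj rho).

Definition nfaces (rho : rotation) : nat := #|porbits (face_perm rho)|.

Local Open Scope ring_scope.

(* Euler's formula for a connected cubic graph, where |E| = 3|V|/2. *)
Definition genus (rho : rotation) : rat :=
  1 + #|G|%:R / 4%:R - (nfaces rho)%:R / 2%:R.

(* For connected cubic [G] the rational [genus rho] is a natural number, so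
   [Num.truncn] only changes its type. *)
Definition genus_poly : {poly int} :=
  \sum_(rho : rotation) 'X^(Num.truncn (genus rho)).

End Graph.

(* An isomorphism M(G) -> M(H): a bijection between the ground sets that
   preserves circuits in both directions. *)
Definition cycle_matroid_iso (G H : sgraph) : Prop :=
  exists2 f : edge G -> edge H, bijective f &
    forall C : {set edge G}, circuit C <-> circuit [set f e | e in C].

Record subgraph (G : sgraph) := Subgraph {
  sub_vert : {set G};
  sub_edge : {set {set G}};
  sub_edgeE : sub_edge \subset edge_set G;
  sub_edgeV : forall e, e \in sub_edge -> e \subset sub_vert }.

Definition sub_adj (G : sgraph) (A : subgraph G) : rel G :=
  [rel x y | [set x; y] \in sub_edge A].

Definition whitney_separation (G : sgraph) (A B : subgraph G) (u v : G) : Prop :=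
  [/\ u != v,
      sub_edge A :|: sub_edge B = edge_set G,
      [disjoint sub_edge A & sub_edge B],
      sub_vert A :&: sub_vert B = [set u; v]
    & connect (sub_adj A) u v /\ connect (sub_adj B) u v].

Section Twist.
Variables (G : sgraph) (A B : subgraph G) (u v : G).

(* The glued graph is realised on the vertices of [G]: a vertex of [B] keeps its
   name, and a vertex of [A] keeps its name except that u_A is renamed v (= v_B)
   and v_A is renamed u (= u_B). When [A], [B] form a Whitney separation at u, v,
   no edge of [B] coincides with a renamed edge of [A] (both would have ends u
   and v), so the gluing creates no parallel edges. *)
Definition twist_edge : rel G :=
  [rel x y | sub_adj B x y || sub_adj A (tperm u v x) (tperm u v y)].

Lemma edge_setP (x y : G) : ([set x; y] \in edge_set G) = sedge x y.
Proof.
apply/imsetP/idP => [[[a b]]|xy]; last by exists (x, y); rewrite ?inE.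
rewrite inE /= => ab /setP eq_xy.
have := eq_xy x; have := eq_xy y; have := eq_xy a; have := eq_xy b.
rewrite !inE !eqxx ?orbT /= => /orP[] /eqP bE /orP[] /eqP aE.
- by rewrite aE bE sedge_irrefl in ab.
- by rewrite sedge_sym -aE -bE.
- by rewrite -aE -bE.
- by rewrite aE bE sedge_irrefl in ab.
Qed.

Lemma sub_adjW (C : subgraph G) (x y : G) : sub_adj C x y -> sedge x y.
Proof. by move=> /(subsetP (sub_edgeE C)); rewrite edge_setP. Qed.

Lemma twist_edge_sym : symmetric twist_edge.
Proof. by move=> x y; rewrite /twist_edge /sub_adj /= setUC [in X in _ || X]setUC. Qed.

Lemma twist_edge_irrefl : irreflexive twist_edge.
Proof.
by move=> x; apply/norP; split; apply/negP => /sub_adjW; rewrite sedge_irrefl.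
Qed.

Definition whitney_twist : sgraph := SGraph twist_edge_sym twist_edge_irrefl.

Definition balanced_twist : Prop :=
  @deg whitney_twist u = deg u /\ @deg whitney_twist v = deg v.

End Twist.

(* Main.v *)
Require Import Defs.
From HB Require Import structures.
From mathcomp Require Import all_boot all_order all_algebra all_fingroup.
From mathcomp Require Import ring.

(** Both halves are proved by reading the genus polynomial off the space of
    flows (circulations) of the graph.

    A rotation system thickens a cubic graph to an oriented surface whose
    boundary components are the faces. The first homology of this surface is
    the space of flows, and the radical of its intersection form has dimension
    F - 1, where F is the number of faces. The form is a sum of contributions of
    the vertices: if the three darts leaving a vertex carry z1, z2, z3 in the
    order of the rotation, so that z1 + z2 + z3 = 0, the contribution is a
    constant times z1 w2 - z2 w1. It changes sign with the rotation and is
    insensitive to a common change of sign of the three coordinates. With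
    coefficients in the field of five elements, where 2 and 3 are invertible,
    dimensions become cardinalities, and the formula for F is
    [card_faces_radical]. Hence two cubic graphs have the same genus polynomial
    once their flow spaces are isomorphic in a way that matches vertices with
    vertices and preserves, up to one sign per vertex, the three values around
    each vertex ([genus_poly_flow_correspondence]).

    For a balanced twist the isomorphism negates the flow on the side A. When A
    has a single edge at u and a single edge at v, these two edges carry
    opposite flows out of u and v, so that exchanging their ends does not change
    the values around u and v ([genus_poly_twist1]). Otherwise B has a single
    edge at u and at v, and twisting B in place of A gives an isomorphic graph.

    For an isomorphism f of cycle matroids, the sets of edges that meet every
    circuit evenly are the edge cuts ([even_is_cut]), so f preserves cuts. The
    image of a vertex star is then a cut of three edges, but it need not be a
    star. It is one up to series, where two edges are in series when they
    form a cut. To see this, let S be the union of the series classes of the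
    edges of a three-edge cut, and delete S. The vertices that become isolated
    are those whose star spans the same series classes S, and each of the other
    components is bridgeless of maximal degree at most three, so its edges form
    a single connected component of the matroid of the remaining edges. The
    number of all components is determined by the number of cuts inside S. So
    the number of isolated vertices depends on the matroid only
    ([card_isolated]), and counting yields a bijection of the vertices that
    respects stars up to series ([series_closure_star_bijection]). Flows on two
    edges in series agree up to sign, so only the choice of signs remains: the n
    images of the stars lie in a cut space of dimension n - 1, and the
    coefficients of a linear relation among them, which are all equal up to
    sign, turn f into an isomorphism of flow spaces ([sign_lift]). *)

Set Implicit Arguments.
Unset Strict Implicit.
Unset Printing Implicit Defensive.
Import GRing.Theory.

(** * Edge cuts and circuits *)

Section Cuts.
Variable G : sgraph.

Lemma edge_ends (e : edge G) : exists x y : G, sedge x y /\ val e = [set x; y].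
Proof. by have /imsetP[[x y]] := valP e; rewrite inE => xy ->; exists x, y. Qed.

Lemma edge_ex (x y : G) : sedge x y -> exists e : edge G, val e = [set x; y].
Proof. by rewrite -edge_setP => xy; exists (Sub [set x; y] xy). Qed.

Definition cut (X : {set G}) : {set edge G} :=
  [set e | (val e :&: X != set0) && (val e :\: X != set0)].

Lemma mem_cut (e : edge G) x y X : val e = [set x; y] ->
  (e \in cut X) = (x \in X) (+) (y \in X).
Proof.
move=> eE; rewrite inE eE; apply/andP/idP => [[/set0Pn[s] + /set0Pn[t]]|].
  rewrite !inE => /andP[/orP[]/eqP-> sX] /andP[tX /orP[]/eqP tE];
  by move: tX; rewrite tE sX // => /negPf->.
have [xX|xX] := boolP (x \in X) => /= [yX|yX]; split; apply/set0Pn.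
- by exists x; rewrite !inE eqxx.
- by exists y; rewrite !inE eqxx yX orbT.
- by exists y; rewrite !inE eqxx yX orbT.
- by exists x; rewrite !inE eqxx xX.
Qed.

Definition is_cut (D : {set edge G}) : bool := [exists X, D == cut X].

Definition joins (D : {set edge G}) : rel G :=
  [rel x y | [set x; y] \in [set val e | e in D]].

Lemma joinsE D (e : edge G) x y : val e = [set x; y] -> joins D x y = (e \in D).
Proof. by move=> eE; rewrite /joins /= -eE mem_imset //; apply: val_inj. Qed.

Lemma joinsC D : symmetric (joins D).
Proof. by move=> x y; rewrite /joins /= setUC. Qed.

Fixpoint walk_parity (D : {set edge G}) (x : G) (s : seq G) : bool :=
  if s is y :: s' then joins D x y (+) walk_parity D y s' else false.

Lemma walk_parity_cat D x s t :
  walk_parity D x (s ++ t) = walk_parity D x s (+) walk_parity D (last x s) t.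
Proof. by elim: s x => //= y s IHs x; rewrite IHs addbA. Qed.

Lemma walk_parity_pairmap D x s :
  walk_parity D x s = odd (count id (pairmap (joins D) x s)).
Proof. by elim: s x => //= y s IHs x; rewrite IHs oddD; case: (joins D x y). Qed.

(** This fails for two vertices, where both steps traverse the same edge; it is
    what makes counting edges of a cycle the same as counting steps. *)
Lemma cycle_next_inj (c : seq G) : 2 < size c -> uniq c ->
  {in c &, injective (fun z => [set z; next c z])}.
Proof.
move=> c3 Uc z w zc wc /= eq_zw; apply/eqP; apply: contraT => zw.
have [i c' cE] := rot_to zc.
have Uc' : uniq (z :: c') by rewrite -cE rot_uniq.
have c'2 : 1 < size c' by have := congr1 size cE; rewrite size_rot /= => E; rewrite E in c3.
have nE t : next c t = next (z :: c') t by rewrite -cE next_rot.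
have : w \in [set z; next c z] by rewrite eq_zw !inE eqxx.
rewrite !inE eq_sym (negPf zw) /= => /eqP wE.
have : z \in [set w; next c w] by rewrite -eq_zw !inE eqxx.
rewrite !inE (negPf zw) /= wE !nE.
case: c' c'2 Uc' {cE nE} => [|y [|x c']] //= _.
rewrite !inE !negb_or => /and3P[/and3P[zy zx _] _ _].
by rewrite eqxx (eq_sym y) (negPf zy) eqxx (negPf zx).
Qed.

Lemma map_next (x : G) (p : seq G) (e : G -> G -> bool) : uniq (x :: p) ->
  [seq e z (next (x :: p) z) | z <- x :: p] = pairmap e x (rcons p x).
Proof.
move=> U; apply: (@eq_from_nth _ false); first by rewrite size_map size_pairmap size_rcons.
move=> i; rewrite size_map => i_lt.
rewrite (nth_map x) // (nth_pairmap x) ?size_rcons //.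
rewrite next_nth mem_nth // index_uniq // -rcons_cons nth_rcons i_lt; congr (e _ _).
rewrite nth_rcons; case: ltngtP => // [ip|->]; last by rewrite nth_default.
by rewrite nth_default // ltnW.
Qed.

Lemma circuit_parity (D C : {set edge G}) (x : G) (p : seq G) :
  2 < size (x :: p) -> uniq (x :: p) ->
  [set val e | e in C] = [set [set z; next (x :: p) z] | z in x :: p] ->
  odd #|D :&: C| = walk_parity D x (rcons p x).
Proof.
set c := x :: p => c3 Uc CE.
have nI := cycle_next_inj c3 Uc.
rewrite walk_parity_pairmap -map_next // count_map -size_filter.
rewrite -(card_imset _ val_inj).
pose N := [seq z <- c | joins D z (next c z)].
have -> : [set val e | e in D :&: C] = [set [set z; next c z] | z in N].
  apply/setP=> A; apply/imsetP/imsetP => [[e]|[z]].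
    rewrite inE => /andP[eD eC] ->.
    have : val e \in [set val e | e in C] by rewrite imset_f.
    rewrite CE => /imsetP[z zc eE]; exists z => //.
    by rewrite mem_filter zc (joinsE D eE) eD.
  rewrite mem_filter => /andP[/imsetP[e eD eE] zc] ->; exists e => //.
  have : [set z; next c z] \in [set val e | e in C] by rewrite CE; apply/imsetP; exists z.
  by case/imsetP => e' e'C; rewrite eE inE eD => /val_inj->.
rewrite card_in_imset; last first.
  by move=> z w; rewrite !mem_filter => /andP[_ zc] /andP[_ wc]; apply: nI.
by rewrite (card_uniqP _) ?filter_uniq.
Qed.

Lemma circuit_of_cycle (c : seq G) : 2 < size c -> ucycle (@sedge G) c ->
  exists2 C : {set edge G}, circuit C &
    [set val e | e in C] = [set [set z; next c z] | z in c].
Proof.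
move=> c3 cC; have /andP[cP _] := cC.
pose C := [set e : edge G | val e \in [set [set z; next c z] | z in c]].
have CE : [set val e | e in C] = [set [set z; next c z] | z in c].
  apply/setP => A; apply/imsetP/idP => [[e]|AE]; first by rewrite inE => ? ->.
  have /imsetP[z zc E] := AE.
  have [e eE] := edge_ex (next_cycle cP zc).
  by exists e; rewrite ?inE eE -?E.
by exists C => //; exists c.
Qed.

Lemma walk_parity_cut X x s : path (@sedge G) x s ->
  walk_parity (cut X) x s = (x \in X) (+) (last x s \in X).
Proof.
elim: s x => [|y s IHs] x /=; first by rewrite addbb.
case/andP=> xy /IHs->; have [e eE] := edge_ex xy.
by rewrite (joinsE _ eE) (mem_cut _ eE) addbA addbK.
Qed.

Lemma cut_circuit_even X C : circuit C -> ~~ odd #|cut X :&: C|.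
Proof.
case=> -[|x p] [c3 /andP[cP Uc] CE] //.
by rewrite (circuit_parity _ c3 Uc CE) walk_parity_cut // last_rcons addbb.
Qed.

Section Even.
Variable D : {set edge G}.
Hypothesis D_even : forall C, circuit C -> ~~ odd #|D :&: C|.

Lemma cycle_even x p : path (@sedge G) x (rcons p x) -> uniq (x :: p) ->
  walk_parity D x (rcons p x) = false.
Proof.
move=> pP U; case: p pP U => [|y [|z p]] pP U.
- by rewrite /= sedge_irrefl in pP.
- by rewrite /= joinsC addbF addbb.
have [||C CC CE] := @circuit_of_cycle (x :: y :: z :: p); rewrite /ucycle ?U ?andbT //.
by rewrite -(circuit_parity _ _ U CE) //; apply/negbTE/D_even.
Qed.

(** A walk is shortened one loop at a time: prepending a vertex that already
    occurs on a simple walk closes a cycle, which has even parity, or goes back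
    and forth along one edge. *)
Lemma simple_walk x s : path (@sedge G) x s -> exists p,
  [/\ path (@sedge G) x p, uniq (x :: p), last x p = last x s
    & walk_parity D x p = walk_parity D x s].
Proof.
elim: s x => [|y s IHs] x; first by exists [::].
case/andP=> xy /IHs[p [pP U pL pE]].
have [|xp] := boolP (x \in y :: p); last first.
  by exists (y :: p); rewrite cons_uniq xp U [path _ _ _]/= xy pP [last _ _]/= pL /= -pE.
rewrite inE => /orP[/eqP xE|xp]; first by rewrite xE sedge_irrefl in xy.
case/splitPr: xp pP U pL pE => p1 p2; rewrite cat_path => /= /andP[p1P /andP[yx p2P]].
rewrite -[_ && _]/(uniq ((y :: p1) ++ x :: p2)) cat_uniq => /and3P[U1 /norP[xp1 _] U2].
rewrite last_cat /= => pL pE; exists p2; split=> //.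
rewrite -pE walk_parity_cat /= !addbA.
have := @cycle_even x (y :: p1); rewrite rcons_path /= xy p1P yx => /(_ isT).
rewrite -[_ && uniq _]/(uniq (y :: p1)) U1 andbT => /(_ xp1).
by rewrite -cats1 walk_parity_cat /= addbF addbA => ->.
Qed.

Lemma closed_walk_even x s : path (@sedge G) x s -> last x s = x ->
  walk_parity D x s = false.
Proof.
move=> /simple_walk[[|y p] [_ U <- <-]] // E.
by move: U; rewrite -{1}E /= mem_last.
Qed.

(** The two sides of the cut are the vertices reached from a root by walks of
    even and of odd parity; this is well defined since closed walks are even. *)
Lemma even_is_cut : connected G -> is_cut D.
Proof.
move=> G_conn; have [V0|[r _]] := set_0Vmem [set: G].
  apply/existsP; exists set0; apply/eqP/setP => e.
  by have [x _] := edge_ends e; have := in_setT x; rewrite V0 inE.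
have walk x y : exists p, path (@sedge G) x p /\ last x p = y.
  by have /connectP[p pP ->] := G_conn x y; exists p.
have [p pP] := fin_all_exists (walk r).
apply/existsP; exists [set x | walk_parity D r (p x)]; apply/eqP/setP => e.
have [x [y [xy eE]]] := edge_ends e; rewrite (mem_cut _ eE) !inE.
have [pxP pxL] := pP x; have [pyP pyL] := pP y; have [q [qP qL]] := walk y r.
have := @closed_walk_even r (p x ++ y :: q).
rewrite cat_path last_cat /= pxP pxL xy qP qL => /(_ isT erefl).
have := @closed_walk_even r (p y ++ q).
rewrite cat_path last_cat pyP pyL qP qL => /(_ isT erefl).
rewrite !walk_parity_cat /= pxL pyL (joinsE _ eE).
by case: (e \in D); case: (walk_parity D y q); case: (walk_parity D r (p x));
  case: (walk_parity D r (p y)).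
Qed.
End Even.
End Cuts.

(** Cuts are the sets that meet every circuit evenly, which is a property that
    only refers to circuits. *)
Lemma cycle_matroid_iso_cut (G H : sgraph) (f : edge G -> edge H) (D : {set edge G}) :
  connected H -> bijective f ->
  (forall C : {set edge G}, circuit C <-> circuit [set f e | e in C]) ->
  is_cut D -> is_cut (f @: D).
Proof.
move=> H_conn [f' fK f'K] fC /existsP[X /eqP->]; apply: even_is_cut => // C' CC'.
have C'E : C' = f @: (f' @: C').
  by rewrite -imset_comp (eq_imset _ (f'K : f \o f' =1 id)) imset_id.
rewrite C'E -imsetI; last by move=> ? ? _ _; apply: (can_inj fK).
by rewrite card_imset; [apply: cut_circuit_even; apply/fC; rewrite -C'E | apply: can_inj fK].
Qed.

(** * Series classes and the stars of a cubic graph *)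

(** The bijection matches the elements of corresponding fibres by their rank. *)
Lemma fiber_bijection (V W T : finType) (a : V -> T) (b : W -> T) (w0 : W) :
  (forall t, #|[pred v | a v == t]| = #|[pred w | b w == t]|) ->
  exists2 g : V -> W, bijective g & forall v, b (g v) = a v.
Proof.
move=> ab; have VW : #|V| = #|W|.
  rewrite -[LHS]sum1_card -[RHS]sum1_card (partition_big a predT) //=.
  rewrite [RHS](partition_big b predT) //=.
  by apply: eq_bigr => t _; have := ab t; rewrite -!sum1_card.
pose E v := enum [pred v' | a v' == a v].
pose E' v := enum [pred w | b w == a v].
pose g v := nth w0 (E' v) (index v (E v)).
have gI v : index v (E v) < size (E' v).
  by rewrite -cardE -ab cardE index_mem mem_enum inE.
have gE v : b (g v) = a v.
  by apply/eqP; have := mem_nth w0 (gI v); rewrite mem_enum inE.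
exists g => //; apply: inj_card_bij; last by rewrite VW.
move=> v v' eq_g; have eq_a : a v = a v' by rewrite -!gE eq_g.
have EE : E v = E v' by rewrite /E eq_a.
have E'E : E' v = E' v' by rewrite /E' eq_a.
move/eqP: eq_g; rewrite /g E'E nth_uniq ?enum_uniq -?E'E ?gI //; last by rewrite E'E gI.
rewrite EE => /eqP/(congr1 (nth v (E v'))).
by rewrite !nth_index // mem_enum inE ?eq_a.
Qed.

(** Symmetric difference: the addition of the binary cut space. *)
Definition symd (T : finType) (A B : {set T}) : {set T} :=
  [set x | (x \in A) (+) (x \in B)].

Section CutSpace.
Variable G : sgraph.
Implicit Types (D : {set edge G}) (X Y W : {set G}) (e g : edge G).

Lemma cut_symd X Y : cut (symd X Y) = symd (cut X) (cut Y).
Proof.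
apply/setP => e; have [x [y [_ eE]]] := edge_ends e.
rewrite [RHS]inE !(mem_cut _ eE) !inE.
by case: (x \in X); case: (x \in Y); case: (y \in X); case: (y \in Y).
Qed.

Lemma is_cut_symd D D' : is_cut D -> is_cut D' -> is_cut (symd D D').
Proof.
move=> /existsP[X /eqP->] /existsP[Y /eqP->].
by apply/existsP; exists (symd X Y); rewrite cut_symd.
Qed.

Lemma is_cut0 : is_cut (set0 : {set edge G}).
Proof.
apply/existsP; exists set0; apply/eqP/setP => e; have [x [y [_ eE]]] := edge_ends e.
by rewrite (mem_cut _ eE) !inE.
Qed.

Definition star (v : G) : {set edge G} := [set e : edge G | v \in val e].

Lemma star_cut v : star v = cut [set v].
Proof.
apply/setP => e; have [x [y [xy eE]]] := edge_ends e.
rewrite (mem_cut _ eE) !inE eE !inE.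
rewrite ![_ == v]eq_sym; case: eqP => [vx|_]; case: eqP => [vy|_] //=.
by rewrite -vx -vy sedge_irrefl in xy.
Qed.

Lemma is_cut_star v : is_cut (star v).
Proof. by apply/existsP; exists [set v]; rewrite star_cut. Qed.

Lemma card_star v : #|star v| = deg v.
Proof.
rewrite /deg -(card_imset _ val_inj).
have inj : {in nbrs v &, injective (fun y => [set v; y])}.
  move=> x y; rewrite !inE => vx vy /setP/(_ x); rewrite !inE eqxx orbT.
  by case/esym/orP => /eqP // xv; rewrite xv sedge_irrefl in vx.
rewrite -(card_in_imset inj); apply: eq_card => A; apply/imsetP/imsetP => [[e]|[y]].
  rewrite inE; have [x [y [xy ->]]] := edge_ends e; rewrite !inE => ve ->.
  case/orP: ve => /eqP->; [exists y | exists x]; rewrite ?inE //; first by rewrite sedge_sym.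
  by rewrite setUC.
by rewrite inE => /edge_ex[e eE] ->; exists e; rewrite // inE eE !inE eqxx.
Qed.

Definition bridgeless : Prop := forall e, ~~ is_cut [set e].

(** An end of a bridge has a second neighbour, because its degree is three, and
    is therefore a cut vertex. *)
Lemma two_connected_bridgeless : two_connected G -> cubic G -> bridgeless.
Proof.
move=> [G_conn _ noz] G_cubic e; apply/negP => /existsP[X /eqP XE].
have [x0 [y0 [xy0 eE0]]] := edge_ends e.
have [x [y [xy eE xX yX]]] : exists x y, [/\ sedge x y, val e = [set x; y], x \in X & y \notin X].
  have : e \in cut X by rewrite -XE inE.
  rewrite (mem_cut _ eE0); have [xX|xX] := boolP (x0 \in X) => /= yX; first by exists x0, y0.
  by exists y0, x0; rewrite sedge_sym setUC.
have [t] : exists t, t \in nbrs x :\ y.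
  apply/card_gt0P; have := cardsD1 y (nbrs x).
  by rewrite inE xy -/(deg x) G_cubic => E; rewrite -(ltn_add2l 1) -E.
rewrite !inE => /andP[ty xt].
have [g gE] := edge_ex xt.
have tX : t \in X.
  have : g \notin cut X.
    rewrite -XE inE; apply/eqP => ge; move: ty; rewrite ge eE in gE.
    have : t \in [set x; y] by rewrite gE !inE eqxx orbT.
    rewrite !inE => /orP[/eqP tx|->] //.
    by rewrite tx sedge_irrefl in xt.
  by rewrite (mem_cut _ gE) xX /= negbK.
have yx : y != x by apply: contraTneq xy => ->; rewrite sedge_irrefl.
have tx : t != x by apply: contraTneq xt => ->; rewrite sedge_irrefl.
apply: (noz x); exists t, y; split=> //.
apply: contra yX => conn; rewrite -(closed_connect _ conn) // => a b /and3P[ax bx ab].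
have [c cE] := edge_ex ab; have : c \notin cut X.
  rewrite -XE inE; apply/eqP => ce; have : x \in [set a; b] by rewrite -cE ce eE !inE eqxx.
  by rewrite !inE ![x == _]eq_sym (negPf ax) (negPf bx).
by rewrite (mem_cut _ cE) => /negbTE; case: (a \in X); case: (b \in X).
Qed.

(** For distinct edges this says that the two edges form a cut; including the
    diagonal, where the symmetric difference is empty, makes it an equivalence. *)
Definition series : rel (edge G) := [rel e g | is_cut (symd [set e] [set g])].

Lemma series_refl : reflexive series.
Proof.
by move=> e; rewrite /series /= (_ : symd _ _ = set0) ?is_cut0 //; apply/setP => g; rewrite !inE addbb.
Qed.

Lemma series_sym : symmetric series.
Proof.
by move=> e g; rewrite /series /=; congr is_cut; apply/setP => h; rewrite !inE addbC.
Qed.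

Lemma series_trans : transitive series.
Proof.
move=> g e h eg gh; have := is_cut_symd eg gh; rewrite /series /=; congr is_cut.
by apply/setP => k; rewrite !inE; case: (k == g); case: (k == e); case: (k == h).
Qed.

Definition series_closure D : {set edge G} := [set g | [exists e in D, series e g]].

Lemma series_closureP D g : reflect (exists2 e, e \in D & series e g) (g \in series_closure D).
Proof. by rewrite inE; apply: exists_inP. Qed.

Lemma sub_series_closure D : D \subset series_closure D.
Proof. by apply/subsetP => e eD; apply/series_closureP; exists e; rewrite ?series_refl. Qed.

Definition three_cut D : bool := is_cut D && (#|D| == 3).

Lemma three_cut_star v : cubic G -> three_cut (star v).
Proof. by move=> G_cubic; rewrite /three_cut is_cut_star card_star G_cubic. Qed.

Hypothesis G_bridgeless : bridgeless.

(** Otherwise adding the cut of the two edges leaves a single edge, a bridge. *)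
Lemma three_cut_series D e g : three_cut D -> e \in D -> g \in D -> series e g -> e = g.
Proof.
move=> /andP[Dc /eqP D3] eD gD eg; apply/eqP; apply: contraT => ne.
have := is_cut_symd Dc eg.
have [h hE] : exists h, D :\ e :\ g = [set h].
  apply/cards1P; have := cardsD1 e D; have := cardsD1 g (D :\ e).
  by rewrite !inE eD gD eq_sym ne D3 => -> [->].
rewrite (_ : symd _ _ = [set h]) ?(negPf (G_bridgeless h)) // -hE.
apply/setP => k; rewrite !inE.
have [->|kg] := eqVneq k g; first by rewrite gD eq_sym (negPf ne).
by have [->|ke] := eqVneq k e; rewrite ?eD ?addbF.
Qed.

(** The edges of a three-edge cut lie in three different series classes, so that
    being covered by the three classes of another such cut leaves no freedom. *)
Lemma three_cut_closure_eq D D' : three_cut D -> three_cut D' -> D' \subset series_closure D ->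
  series_closure D' = series_closure D.
Proof.
move=> D3 D'3 /subsetP sub.
have ex e : exists d, (e \in D') ==> (d \in D) && series d e.
  have [eD'|_] := boolP (e \in D'); last by exists e.
  by have /series_closureP[d dD de] := sub e eD'; exists d; rewrite dD.
have [phi phiP] := fin_all_exists ex.
have phiD e : e \in D' -> phi e \in D /\ series (phi e) e.
  by move=> eD'; have := phiP e; rewrite eD' => /andP[].
have phi_inj : {in D' &, injective phi}.
  move=> e g eD' gD' eq_phi; apply: (three_cut_series D'3) => //.
  have [_ e1] := phiD e eD'; have [_ g1] := phiD g gD'.
  by rewrite series_sym in e1; apply: series_trans e1 _; rewrite eq_phi.
have phi_im : phi @: D' = D.
  apply/eqP; rewrite eqEcard card_in_imset //.
  move: D3 D'3 => /andP[_ /eqP->] /andP[_ /eqP->]; rewrite leqnn andbT.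
  by apply/subsetP => _ /imsetP[e eD' ->]; have [] := phiD e eD'.
apply/setP => g; apply/series_closureP/series_closureP => -[e].
  move=> eD' eg; have [pD pe] := phiD e eD'; exists (phi e) => //.
  exact: series_trans pe eg.
rewrite -{1}phi_im => /imsetP[d dD' ->] dg; exists d => //; have [_ pd] := phiD d dD'.
by apply: series_trans dg; rewrite series_sym.
Qed.

Section Reduction.
Variables (D0 : {set edge G}) (G_cubic : cubic G) (G_conn : connected G).
Hypothesis D0_3 : three_cut D0.
Local Notation S := (series_closure D0).

(** Replacing an edge by one in series with it changes a set by a cut. *)
Lemma reduce_mod_series D : D \subset S ->
  exists2 D' : {set edge G}, D' \subset D0 & is_cut (symd D D').
Proof.
have [n] := ubnP #|D|; elim: n D => // n IHn D leDn DS.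
have [->|[g gD]] := set_0Vmem D.
  by exists set0; rewrite ?sub0set // (_ : symd _ _ = set0) ?is_cut0 //; apply/setP=> e; rewrite !inE.
have [||D1 D1D0 D1c] := IHn (D :\ g).
- by rewrite (cardsD1 g D) gD in leDn.
- exact: subset_trans (subsetDl _ _) DS.
have /series_closureP[d dD0 dg] := subsetP DS g gD.
exists (symd D1 [set d]).
  apply/subsetP => e; rewrite !inE; have [->|_] := eqVneq e d => //.
  by rewrite addbF; apply: (subsetP D1D0).
have := is_cut_symd D1c dg; congr is_cut; apply/setP => e; rewrite !inE.
have [->|_] := eqVneq e g; rewrite ?gD /=.
  by case: (g \in D1); case: (g == d).
by case: (e \in D1); case: (e == d); case: (e \in D).
Qed.

(** Deleting [S] creates no bridge. Modulo series the cut is [g] together with a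
    subset of [D0], and adding [D0] if necessary this subset has at most one
    element: it cannot be empty as there is no bridge, and a single element
    would be in series with [g]. *)
Lemma cut_leaving_closure D g : is_cut D -> g \in D -> D :\ g \subset S -> g \in S.
Proof.
move=> Dc gD DS; apply: contraT => gS.
have [D' D'D0 D'c] := reduce_mod_series DS.
have /andP[D0c /eqP D0_card] := D0_3.
have gD0 : g \notin D0 by apply: contra gS; apply: (subsetP (sub_series_closure _)).
have small (E : {set edge G}) : E \subset D0 -> #|E| <= 1 -> ~~ is_cut (symd [set g] E).
  move=> ED0; rewrite leq_eqVlt ltnS leqn0 cards_eq0 => /orP[/cards1P[e Ee]|/eqP->].
    rewrite Ee; apply: contra gS => eg; apply/series_closureP; exists e.
      by apply: (subsetP ED0); rewrite Ee inE.
    by rewrite series_sym.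
  rewrite (_ : symd _ _ = [set g]) ?G_bridgeless //.
  by apply/setP => e; rewrite !inE addbF.
have gD' : is_cut (symd [set g] D').
  have := is_cut_symd Dc D'c; congr is_cut; apply/setP => e; rewrite !inE.
  by have [->|_] := eqVneq e g; rewrite ?gD /=; case: (e \in D); case: (e \in D').
have gD'' : is_cut (symd [set g] (D0 :\: D')).
  have := is_cut_symd gD' D0c; congr is_cut; apply/setP => e; rewrite !inE.
  have [eD'|eD'] := boolP (e \in D'); first by rewrite (subsetP D'D0) //= addbF; case: (_ == g).
  by rewrite addbF.
have [D'1|D'1] := leqP #|D'| 1; first by rewrite (negPf (small _ D'D0 D'1)) in gD'.
rewrite (negPf (small _ (subsetDl _ _) _)) in gD'' => //.
by rewrite cardsD (setIidPr D'D0) D0_card leq_subLR addn1.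
Qed.

Definition isolated : {set G} := [set v | star v \subset S].

Lemma isolatedE v : (v \in isolated) = (series_closure (star v) == S).
Proof.
rewrite inE; apply/idP/eqP => [sub|<-]; last exact: sub_series_closure.
by apply: three_cut_closure_eq => //; apply: three_cut_star.
Qed.

Definition inner_cuts : {set {set edge G}} := [set D : {set edge G} | (D \subset S) && is_cut D].

(** The unions of connected components of the matroid obtained by deleting [S],
    in terms of its cuts, which are the traces on the complement of [S] of the
    cuts of [G]: a set of edges is such a union when the trace on it of every
    cut is again a cut. *)
Definition separators : {set {set edge G}} :=
  [set Y : {set edge G} | (Y \subset ~: S) &&
    [forall (D : {set edge G} | is_cut D),
       [exists (D' : {set edge G} | is_cut D'), D :&: Y == D' :\: S]]].

(** The unions of connected components of the graph obtained by deleting [S]. *)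
Definition closed_sets : {set {set G}} := [set X | cut X \subset S].

(** A union of matroid components contains all remaining edges at a vertex as
    soon as it contains one of them. Otherwise it splits the at most three
    remaining edges of the star into two cuts, one of which is a single edge,
    and there is no bridge. *)
Lemma separator_star (Y : {set edge G}) x e g : Y \in separators -> e \in star x -> g \in star x ->
  e \notin S -> g \notin S -> e \in Y -> g \in Y.
Proof.
rewrite inE => /andP[_ /forall_inP YP] ex gx eS gS eY; apply: contraT => gY.
have /exists_inP[D Dc /eqP DE] := YP _ (is_cut_star x).
have mem_D h : h \notin S -> (h \in D) = (h \in star x) && (h \in Y).
  by move=> hS; have /setP/(_ h) := DE; rewrite in_setI in_setD hS.
have [h hx] : exists h, star x = [set e; g; h].
  have [h hE] : exists h, star x :\ e :\ g = [set h].
    apply/cards1P; have := cardsD1 e (star x); have := cardsD1 g (star x :\ e).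
    have ge : g != e by apply: contraNneq gY => ->.
    by rewrite [g \in _]in_setD1 ex gx ge card_star G_cubic => -> [->].
  exists h; rewrite -(setD1K ex) -(setD1K (a := g) (A := star x :\ e)) ?hE ?setUA //.
  by rewrite !inE in gx *; rewrite gx andbT; apply: contraNneq gY => ->.
have [hY|hY] := boolP (h \in Y).
  have : g \in S; last by rewrite (negPf gS).
  apply: (cut_leaving_closure (is_cut_symd (is_cut_star x) Dc)).
    by rewrite in_set gx mem_D // gx (negPf gY).
  apply/subsetP => k; rewrite in_setD1 in_set => /andP[kg]; apply: contraTT => kS.
  rewrite mem_D // hx !inE (negPf kg) orbF.
  by have [->|_] := eqVneq k e; [rewrite eY | case: eqP => // ->; rewrite hY].
have : e \in S; last by rewrite (negPf eS).
apply: (cut_leaving_closure Dc); first by rewrite mem_D // ex.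
apply/subsetP => k; rewrite in_setD1 => /andP[ke]; apply: contraTT => kS.
rewrite mem_D // hx !inE (negPf ke) /=.
by case: eqP => [->|_]; [rewrite (negPf gY) | case: eqP => // ->; rewrite (negPf hY)].
Qed.

Lemma closed_setsP X : reflect (forall e x y, e \notin S -> val e = [set x; y] ->
  (x \in X) = (y \in X)) (X \in closed_sets).
Proof.
rewrite inE; apply: (iffP subsetP) => [XS e x y eS eE|XP e].
  have : e \notin cut X by apply: contra eS; apply: XS.
  by rewrite (mem_cut _ eE); case: (x \in X); case: (y \in X).
have [x [y [_ eE]]] := edge_ends e; rewrite (mem_cut _ eE).
by apply: contraLR => eS; rewrite (XP e x y) // addbb.
Qed.

Lemma cutC X : cut (~: X) = cut X.
Proof.
apply/setP => e; have [x [y [_ eE]]] := edge_ends e.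
by rewrite !(mem_cut _ eE) !inE addNb addbN negbK.
Qed.

Lemma cut_inj (r : G) X Y : (r \in X) = (r \in Y) -> cut X = cut Y -> X = Y.
Proof.
move=> rXY XY; apply/setP => x.
have cl : closed (@sedge G) [pred y | (y \in X) (+) (y \in Y)].
  move=> s t st; have [e eE] := edge_ex st; rewrite !inE.
  have /setP/(_ e) := XY; rewrite !(mem_cut _ eE).
  by case: (s \in X); case: (s \in Y); case: (t \in X); case: (t \in Y).
have := closed_connect cl (G_conn r x); rewrite !inE rXY addbb.
by case: (x \in X); case: (x \in Y).
Qed.

(** A set of vertices is determined by its cut and by the side of a root. *)
Lemma card_closed_sets (r : G) : #|closed_sets| = 2 * #|inner_cuts|.
Proof.
pose h X := (r \in X, cut X).
have h_inj : {in closed_sets &, injective h}.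
  by move=> X Y _ _ [rXY XY]; apply: cut_inj rXY XY.
rewrite -card_bool -cardsT -cardsX -(card_in_imset h_inj).
apply: eq_card => -[b D]; rewrite in_setX in_setT /= [D \in _]inE.
apply/imsetP/andP => [[X XS [_ ->]]|[DS /existsP[X /eqP XD]]].
  by rewrite inE in XS; split=> //; apply/existsP; exists X.
have XS : X \in closed_sets by rewrite inE -XD.
have [<-|rX] := eqVneq (r \in X) b; first by exists X; rewrite // /h XD.
exists (~: X); first by rewrite inE cutC -XD.
by rewrite /h cutC -XD inE; move: rX; case: (r \in X); case: b.
Qed.

Definition inner_edges X : {set edge G} := [set e | (e \notin S) && (val e \subset X)].

Lemma mem_inner_edges X e x y : X \in closed_sets -> e \notin S -> val e = [set x; y] ->
  (e \in inner_edges X) = (x \in X).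
Proof.
move=> /closed_setsP XP eS eE; rewrite inE eS eE subUset !sub1set -(XP e x y) //.
by rewrite andbb.
Qed.

Lemma star_ends e x : e \in star x -> exists y, val e = [set x; y].
Proof.
rewrite inE; have [s [t [_ eE]]] := edge_ends e; rewrite eE !inE.
by case/orP => /eqP->; [exists t | exists s; rewrite setUC].
Qed.

Lemma not_isolated v : v \notin isolated -> exists2 e, e \in star v & e \notin S.
Proof. by rewrite inE => /subsetPn. Qed.

Lemma isolated_star v e : v \in isolated -> e \in star v -> e \in S.
Proof. by rewrite inE => /subsetP; apply. Qed.

(** A union of components of the graph without [S] consists of any set of
    isolated vertices and of a union of nontrivial components, and the latter
    correspond to the components of the matroid. *)
Lemma card_closed_sets_separators : #|closed_sets| = 2 ^ #|isolated| * #|separators|.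
Proof.
pose h X := (X :&: isolated, inner_edges X).
have h_inj : {in closed_sets &, injective h}.
  move=> X Y XC YC [eqI eqE]; apply/setP => v.
  have [vI|/not_isolated[e ev eS]] := boolP (v \in isolated).
    by have /setP/(_ v) := eqI; rewrite !in_setI vI !andbT.
  have [y eE] := star_ends ev.
  by rewrite -(mem_inner_edges XC eS eE) -(mem_inner_edges YC eS eE) eqE.
rewrite -card_powerset -cardsX -(card_in_imset h_inj).
apply: eq_card => -[I Y]; rewrite in_setX powersetE /=.
apply/imsetP/andP => [[X XC [-> ->]]|[II YS]].
  rewrite subsetIr inE; split=> //; apply/andP; split.
    by apply/subsetP => e; rewrite !inE => /andP[].
  apply/forall_inP => _ /existsP[W /eqP->]; apply/exists_inP; exists (cut (W :&: X)).
    by apply/existsP; exists (W :&: X).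
  apply/eqP/setP => e; rewrite in_setI in_setD; have [eS|eS] := boolP (e \in S).
    by rewrite [e \in inner_edges X]inE eS andbF.
  have [x [y [_ eE]]] := edge_ends e; rewrite (mem_inner_edges XC eS eE) !(mem_cut _ eE) !in_setI.
  move/closed_setsP: XC => /(_ e x y eS eE) <-.
  by case: (x \in X); rewrite ?andbT ?andbF.
have YnS e : e \in Y -> e \notin S.
  by move: YS; rewrite inE => /andP[/subsetP sub _] /sub; rewrite inE.
pose X := I :|: [set v | [exists e in Y, e \in star v]].
have XE v : v \notin isolated -> (v \in X) = [exists e in Y, e \in star v].
  move=> vI; have /negbTE vI' : v \notin I by apply: contra vI; apply: (subsetP II).
  by rewrite in_setU vI' inE.
have notI e v : e \notin S -> e \in star v -> v \notin isolated.
  by move=> eS ev; apply: contra eS => vI; apply: isolated_star vI ev.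
have XY e v : e \notin S -> e \in star v -> (v \in X) = (e \in Y).
  move=> eS ev; rewrite XE ?(notI e) //; apply/exists_inP/idP => [[g gY gv]|eY].
    exact: (separator_star YS gv ev (YnS _ gY) eS gY).
  by exists e.
have endsS e x y : val e = [set x; y] -> e \in star x /\ e \in star y.
  by move=> eE; rewrite !inE eE !inE !eqxx orbT.
have XC : X \in closed_sets.
  by apply/closed_setsP => e x y eS /endsS[ex ey]; rewrite !(XY e).
exists X => //; congr (_, _); last first.
  apply/setP => e; have [x [y [_ eE]]] := edge_ends e; have [ex ey] := endsS _ _ _ eE.
  have [eS|eS] := boolP (e \in S); last by rewrite (mem_inner_edges XC eS eE) (XY e).
  by rewrite inE eS; apply/negbTE; apply: contraL eS; apply: YnS.
apply/setP => v; rewrite in_setI.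
have [vI|vI] := boolP (v \in isolated); last first.
  by rewrite andbF; apply/negbTE; apply: contra vI; apply: (subsetP II).
rewrite andbT in_setU; case: (v \in I) => //=; rewrite inE.
apply/esym/negbTE/negP => /exists_inP[e eY ev].
by have := YnS e eY; rewrite (isolated_star vI ev).
Qed.

(** All the other numbers in this equation are determined by the cuts of the
    graph, hence so is the number of isolated vertices. *)
Lemma card_isolated (r : G) : 2 ^ #|isolated| * #|separators| = 2 * #|inner_cuts|.
Proof. by rewrite -card_closed_sets_separators (card_closed_sets r). Qed.

Lemma separators_gt0 : 0 < #|separators|.
Proof.
apply/card_gt0P; exists set0; rewrite inE sub0set; apply/forall_inP => D _.
by apply/exists_inP; exists set0; rewrite ?is_cut0 // setI0 set0D.
Qed.
End Reduction.
End CutSpace.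

Section Transfer.
Variables (G H : sgraph) (f : edge G -> edge H).
Hypotheses (f_bij : bijective f) (f_cut : forall D : {set edge G}, is_cut (f @: D) = is_cut D).
Hypotheses (G_cubic : cubic G) (H_cubic : cubic H) (G_conn : connected G) (H_conn : connected H).
Hypotheses (G_bridgeless : bridgeless G) (H_bridgeless : bridgeless H).

Lemma f_inj : injective f. Proof. exact: bij_inj f_bij. Qed.

Lemma imset_onto (D : {set edge H}) : exists D' : {set edge G}, D = f @: D'.
Proof.
exists (f @^-1: D); apply/setP => e; have [f' fK f'K] := f_bij.
apply/idP/imsetP => [eD|[e' + ->]]; last by rewrite inE.
by exists (f' e); rewrite ?inE f'K.
Qed.

Lemma imset_symd (D D' : {set edge G}) : f @: symd D D' = symd (f @: D) (f @: D').
Proof.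
apply/setP => e; have [f' fK f'K] := f_bij.
by rewrite -[e]f'K !inE !(mem_imset _ _ f_inj) !inE.
Qed.

Lemma series_iso e g : series (f e) (f g) = series e g.
Proof. by rewrite /series /= -f_cut imset_symd !imset_set1. Qed.

Lemma series_closure_iso (D : {set edge G}) :
  series_closure (f @: D) = f @: series_closure D.
Proof.
have [f' fK f'K] := f_bij; apply/setP => e; rewrite -[e]f'K (mem_imset _ _ f_inj).
apply/series_closureP/series_closureP => [[_ /imsetP[d dD ->]]|[d dD]].
  by rewrite series_iso; exists d.
by exists (f d); rewrite ?imset_f // series_iso.
Qed.

Lemma three_cut_iso (D : {set edge G}) : three_cut (f @: D) = three_cut D.
Proof. by rewrite /three_cut f_cut card_imset //; apply: f_inj. Qed.

Lemma imset_sub (D D' : {set edge G}) : (f @: D \subset f @: D') = (D \subset D').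
Proof.
apply/subsetP/subsetP => sub e; last by case/imsetP => d /sub dD' ->; apply: imset_f.
by move=> eD; rewrite -(mem_imset _ _ f_inj) sub ?imset_f.
Qed.

Lemma imset_setC (D : {set edge G}) : f @: (~: D) = ~: (f @: D).
Proof.
have [f' fK f'K] := f_bij.
by apply/setP => e; rewrite -[e]f'K !inE !(mem_imset _ _ f_inj) inE.
Qed.

Lemma imset_setI (D D' : {set edge G}) : f @: (D :&: D') = f @: D :&: f @: D'.
Proof. by apply: imsetI => ? ? _ _; apply: f_inj. Qed.

Lemma card_iso_family (P : {set {set edge G}}) (Q : {set {set edge H}}) :
  (forall D : {set edge G}, (f @: D \in Q) = (D \in P)) -> #|Q| = #|P|.
Proof.
move=> QP; rewrite -(card_imset _ (imset_inj f_inj)); apply: eq_card => E.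
have [E' ->] := imset_onto E; rewrite QP.
by apply/idP/imsetP => [E'P|[E'' E''P /(imset_inj f_inj)->]] //; exists E'.
Qed.

Lemma card_inner_cuts_iso (D : {set edge G}) : #|inner_cuts (f @: D)| = #|inner_cuts D|.
Proof. by apply: card_iso_family => E; rewrite !inE series_closure_iso f_cut imset_sub. Qed.

Lemma card_separators_iso (D : {set edge G}) : #|separators (f @: D)| = #|separators D|.
Proof.
apply: card_iso_family => Y; rewrite [in LHS]inE [in RHS]inE series_closure_iso.
rewrite -imset_setC imset_sub; congr (_ && _).
apply/forall_inP/forall_inP => YP E Ec.
  have /exists_inP[E'] := YP (f @: E) (etrans (f_cut E) Ec).
  have [E'' ->] := imset_onto E'; rewrite f_cut => E''c.
  rewrite setDE -imset_setC -!imset_setI -setDE => /eqP/(imset_inj f_inj) eqE.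
  by apply/exists_inP; exists E''; rewrite ?eqE.
have [E' EE] := imset_onto E; rewrite EE f_cut in Ec *.
have /exists_inP[E'' E''c /eqP eqE] := YP E' Ec; apply/exists_inP; exists (f @: E'').
  by rewrite f_cut.
by rewrite setDE -imset_setC -!imset_setI -setDE eqE.
Qed.

Lemma card_isolated_iso (D : {set edge G}) (r : G) (s : H) : three_cut D ->
  #|isolated (f @: D)| = #|isolated D|.
Proof.
move=> D3; have fD3 : three_cut (f @: D) by rewrite three_cut_iso.
have := card_isolated H_bridgeless H_cubic H_conn fD3 s.
rewrite card_inner_cuts_iso -(card_isolated G_bridgeless G_cubic G_conn D3 r).
rewrite card_separators_iso => /eqP.
by rewrite eqn_pmul2r ?separators_gt0 // => /eqP; apply: expnI.
Qed.

(** For each union [t] of the series classes of a three-edge cut, the vertices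
    whose star spans [t] are counted by [card_isolated_iso]. *)
Lemma series_closure_star_bijection (r : G) (s : H) : exists2 b : G -> H, bijective b &
  forall v, series_closure (star (b v)) = f @: series_closure (star v).
Proof.
apply: (@fiber_bijection _ _ _ (fun v => f @: series_closure (star v))
  (fun w => series_closure (star w)) s) => t.
have main (D : {set edge G}) : three_cut D -> t = f @: series_closure D ->
    #|[pred v | f @: series_closure (star v) == t]| = #|[pred w | series_closure (star w) == t]|.
  move=> D3 ->; have fD3 : three_cut (f @: D) by rewrite three_cut_iso.
  transitivity #|isolated D|.
    apply: eq_card => v; rewrite isolatedE // inE.
    by apply/eqP/eqP => [/(imset_inj f_inj)|->].
  rewrite -(card_isolated_iso r s D3); apply: eq_card => w.
  by rewrite isolatedE // inE series_closure_iso.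
have [/existsP[v /eqP vt]|] := boolP [exists v, f @: series_closure (star v) == t].
  by apply: (main (star v)) => //; apply: three_cut_star.
have [/existsP[w /eqP wt]|] := boolP [exists w, series_closure (star w) == t].
  have [D DE] := imset_onto (star w); move=> _; apply: (main D).
    by rewrite -three_cut_iso -DE three_cut_star.
  by rewrite -wt DE series_closure_iso.
rewrite !negb_exists => /forallP nw /forallP nv.
by rewrite !eq_card0 // => x; rewrite inE; apply/negbTE.
Qed.
End Transfer.

(** * Flows over the field with five elements *)

Local Open Scope ring_scope.

Local Notation F := 'F_5.

Lemma F5_2 : 2%:R != 0 :> F. Proof. by []. Qed.

Section Delta.
Variable T : finType.

Lemma sum_delta (x : T) (g : T -> F) : \sum_y (y == x)%:R * g y = g x.
Proof.
rewrite (bigD1 x) //= eqxx mul1r big1 ?addr0 // => y /negPf->.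
by rewrite mul0r.
Qed.

Lemma sum_delta1 (x : T) : \sum_y (y == x)%:R = 1 :> F.
Proof. by rewrite -[RHS](sum_delta x (fun=> 1)); apply: eq_bigr => y _; rewrite mulr1. Qed.

Lemma antisym_sum (k : T -> T -> F) :
  (forall x y, k x y = - k y x) -> \sum_x \sum_y k x y = 0.
Proof.
move=> kN; apply: (mulfI F5_2); rewrite mulr0 mulr_natl mulr2n.
rewrite {2}exchange_big -big_split big1 // => x _.
by rewrite -big_split big1 // => y _; rewrite /= [k y x]kN subrr.
Qed.

End Delta.

Section Flows.
Variables (V : finType) (e : rel V).

Definition flow (z : {ffun V * V -> F}) : bool :=
  [&& [forall x, forall y, z (x, y) == - z (y, x)],
      [forall x, forall y, ~~ e x y ==> (z (x, y) == 0)]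
    & [forall x, \sum_y z (x, y) == 0]].

Definition flows : {set {ffun V * V -> F}} := [set z | flow z].

Lemma flowsP (z : {ffun V * V -> F}) : reflect
  [/\ forall x y, z (x, y) = - z (y, x),
      forall x y, ~~ e x y -> z (x, y) = 0
    & forall x, \sum_y z (x, y) = 0] (z \in flows).
Proof.
rewrite inE; apply: (iffP and3P) => -[zN z0 zD]; split.
- by move=> x y; move/forallP/(_ x)/forallP/(_ y)/eqP: zN.
- by move=> x y xy; move/forallP/(_ x)/forallP/(_ y)/implyP/(_ xy)/eqP: z0.
- by move=> x; move/forallP/(_ x)/eqP: zD.
- by apply/forallP=> x; apply/forallP=> y; rewrite -zN.
- by apply/forallP=> x; apply/forallP=> y; apply/implyP=> /z0->.
- by apply/forallP=> x; rewrite zD.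
Qed.

Lemma flows0 : 0 \in flows.
Proof.
by apply/flowsP; split=> [x y|x y _|x]; rewrite ?ffunE ?oppr0 // big1 // => y _; rewrite ffunE.
Qed.

Definition unit_flow (x y : V) : {ffun V * V -> F} :=
  [ffun d => (d == (x, y))%:R - (d == (y, x))%:R].

Lemma div_unit_flow (x y t : V) :
  \sum_s unit_flow x y (t, s) = (t == x)%:R - (t == y)%:R.
Proof.
under eq_bigr => s _ do rewrite ffunE !xpair_eqE -!mulnb !natrM.
by rewrite sumrB -!mulr_sumr !sum_delta1 !mulr1.
Qed.

Lemma unit_flowN x y s t : unit_flow x y (s, t) = - unit_flow x y (t, s).
Proof. by rewrite !ffunE !xpair_eqE opprB ![(_ == x) && _]andbC. Qed.

Definition pairing (g z : {ffun V * V -> F}) : F := \sum_d g d * z d.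

Lemma pairing_unit_flow g x y : pairing g (unit_flow x y) = g (x, y) - g (y, x).
Proof.
rewrite /pairing; under eq_bigr => d _ do rewrite ffunE mulrBr.
by rewrite sumrB; congr (_ - _);
  rewrite -[RHS]sum_delta; apply: eq_bigr => d _; rewrite mulrC.
Qed.

Hypotheses (e_sym : symmetric e) (e_conn : forall x y, connect e x y).

(** A unit of flow sent along a path from [r] to [x]. *)
Lemma path_flow (r x : V) : exists P : {ffun V * V -> F},
  [/\ forall s t, P (s, t) = - P (t, s),
      forall s t, ~~ e s t -> P (s, t) = 0
    & forall t, \sum_s P (t, s) = (t == r)%:R - (t == x)%:R].
Proof.
have /connectP[p pP ->] := e_conn r x; elim: p r pP => [|y p IHp] r /=.
  move=> _; exists 0; split=> [s t|s t _|t]; rewrite ?ffunE ?oppr0 //.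
  by rewrite big1 ?subrr // => s _; rewrite ffunE.
case/andP=> ry /IHp[P [PN P0 PD]].
exists (unit_flow r y + P); split=> [s t|s t st|t].
- by rewrite !ffunE [P (s, t)]PN !xpair_eqE ![(t == _) && _]andbC; ring.
- rewrite !ffunE P0 // addr0.
  have /negPf-> : (s, t) != (r, y).
    by apply: contra st => /eqP[-> ->].
  have /negPf-> : (s, t) != (y, r).
    by apply: contra st => /eqP[-> ->]; rewrite e_sym.
  by rewrite subrr.
- under eq_bigr => x' _ do rewrite ffunE.
  by rewrite big_split /= div_unit_flow PD; ring.
Qed.

(** The orthogonal complement of the flows consists of gradients. Sending a unit
    along a path from the root to [x], then along [xy], then back from [y] gives
    a flow, so that the pairing of [g] with paths is a potential; the factor 2
    comes from pairing over both orientations of each edge. *)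
Lemma orth_flows_gradient (g : {ffun V * V -> F}) :
  (forall x y, g (x, y) = - g (y, x)) ->
  (forall z, z \in flows -> pairing g z = 0) ->
  exists c : {ffun V -> F}, forall x y, e x y -> g (x, y) = c x - c y.
Proof.
move=> gN gz; have [V0|[r _]] := set_0Vmem [set: V].
  by exists 0 => x; have := in_setT x; rewrite V0 inE.
have PE x := path_flow r x.
have [P PP] := fin_all_exists PE.
exists [ffun x => - (pairing g (P x) / 2%:R)] => x y xy; rewrite !ffunE.
have: P x + unit_flow x y - P y \in flows.
  have [PxN Px0 PxD] := PP x; have [PyN Py0 PyD] := PP y.
  apply/flowsP; split=> [s t|s t st|t].
  - by rewrite !ffunE [P x (s, t)]PxN [P y (s, t)]PyN !xpair_eqE ![(t == _) && _]andbC; ring.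
  - rewrite !ffunE Px0 // Py0 //.
    have /negPf-> : (s, t) != (x, y).
      by apply: contra st => /eqP[-> ->].
    have /negPf-> : (s, t) != (y, x).
      by apply: contra st => /eqP[-> ->]; rewrite e_sym.
    by rewrite subrr !addr0 subrr.
  - under eq_bigr => s _ do rewrite 2!ffunE [(- P y) _]ffunE.
    by rewrite sumrB big_split /= div_unit_flow PxD PyD; ring.
move/gz.
have -> : pairing g (P x + unit_flow x y - P y) =
    pairing g (P x) + pairing g (unit_flow x y) - pairing g (P y).
  by rewrite /pairing -big_split -sumrB; apply: eq_bigr => d _; rewrite !ffunE /=; ring.
rewrite pairing_unit_flow [g (y, x)]gN opprK => eq0.
apply: (mulfI F5_2).
rewrite (_ : 2%:R * g (x, y) = pairing g (P y) - pairing g (P x)).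
  by rewrite mulrBr !mulrN ![2%:R * (_ / _)]mulrC !divfK ?F5_2 // opprK addrC.
by apply/eqP; rewrite -subr_eq0 -[X in _ == X]eq0; apply/eqP; ring.
Qed.
End Flows.

(** * Faces and the radical of the intersection form *)

Lemma card_F5 : #|F| = 5%N. Proof. by rewrite card_Fp. Qed.

Lemma card_perm_invariant (T : finType) (s : {perm T}) :
  #|[set p : {ffun T -> F} | [forall d, p (s d) == p d]]| = (5 ^ #|porbits s|)%N.
Proof.
pose Q : {pred {ffun {set T} -> F}} := [pred q in pffun_on (0 : F) (mem (porbits s)) predT].
have <- : #|Q| = (5 ^ #|porbits s|)%N by rewrite card_pffun_on card_F5.
pose h (q : {ffun {set T} -> F}) : {ffun T -> F} := [ffun d => q (porbit s d)].
have h_inj : {in Q &, injective h}.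
  move=> q q' /pffun_onP[q0 _] /pffun_onP[q'0 _] /ffunP eq_h.
  apply/ffunP => A; have [/imsetP[d _ ->]|nA] := boolP (A \in porbits s).
    by have := eq_h d; rewrite !ffunE.
  have /eqP-> : q A == 0 by apply: contraR nA => qA; apply: (subsetP q0).
  by apply/esym/eqP; apply: contraR nA => qA; apply: (subsetP q'0).
rewrite -(card_in_imset h_inj); apply: eq_card => p; rewrite inE.
apply/forallP/imsetP => [pE|[q _ ->] d]; last first.
  rewrite !ffunE; apply/eqP; congr (q _).
  by have := porbit_perm s 1 d; rewrite expg1 => ->.
exists [ffun A => if A \in porbits s then (if [pick d in A] is Some d then p d else 0) else 0].
  apply/pffun_onP; split=> [|//].
  by apply/subsetP=> A; rewrite inE ffunE; case: ifP; rewrite ?eqxx.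
apply/ffunP=> d; rewrite !ffunE imset_f //.
have pI i x : p ((s ^+ i)%g x) = p x.
  by elim: i => [|i IHi]; rewrite ?perm1 // expgSr permM (eqP (pE _)).
case: pickP => [d'|/(_ d)]; last by rewrite porbit_id.
by move=> /porbitP[i ->]; rewrite pI.
Qed.

Section Faces.
Variables (G : sgraph) (rho : rotation G).

Definition succ_at (v : G) : {perm G} := val rho v.

Lemma succ_at_perm_on v : perm_on (nbrs v) (succ_at v).
Proof. by have /forallP/(_ v)/andP[] := valP rho. Qed.

Lemma succ_at_orbit v y : sedge v y -> porbit (succ_at v) y = nbrs v.
Proof.
move=> vy; have /forallP/(_ v)/andP[_ /forall_inP/(_ y)] := valP rho.
by rewrite inE vy => /(_ isT)/eqP.
Qed.

Lemma sedge_succ_at v y : sedge v (succ_at v y) = sedge v y.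
Proof. by have := perm_closed y (succ_at_perm_on v); rewrite !inE. Qed.

Lemma succ_at_out v y : ~~ sedge v y -> succ_at v y = y.
Proof. by move=> vy; apply: (out_perm (succ_at_perm_on v)); rewrite inE. Qed.

(** Functions on darts that are constant on faces, extended by zero. *)
Definition face_potentials : {set {ffun G * G -> F}} :=
  [set P : {ffun G * G -> F} | [forall x, forall y, ~~ sedge x y ==> (P (x, y) == 0)]
         & [forall u, forall v, sedge u v ==> (P (v, succ_at v u) == P (u, v))]].

Lemma face_potentialsP (P : {ffun G * G -> F}) : reflect
  ((forall x y, ~~ sedge x y -> P (x, y) = 0) /\
   (forall u v, sedge u v -> P (v, succ_at v u) = P (u, v))) (P \in face_potentials).
Proof.
rewrite inE; apply: (iffP andP) => -[P0 PI]; split.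
- by move=> x y xy; move/forallP/(_ x)/forallP/(_ y)/implyP/(_ xy)/eqP: P0.
- by move=> x y xy; move/forallP/(_ x)/forallP/(_ y)/implyP/(_ xy)/eqP: PI.
- by apply/forallP=> x; apply/forallP=> y; apply/implyP=> /P0->.
- by apply/forallP=> x; apply/forallP=> y; apply/implyP=> /PI->.
Qed.

Lemma card_face_potentials : #|face_potentials| = (5 ^ nfaces rho)%N.
Proof.
rewrite /nfaces -card_perm_invariant.
pose h (P : {ffun G * G -> F}) : {ffun dart G -> F} := [ffun d => P (val d)].
have h_inj : {in face_potentials &, injective h}.
  move=> P Q /face_potentialsP[P0 _] /face_potentialsP[Q0 _] /ffunP eq_h.
  apply/ffunP=> -[x y]; have [xy|xy] := boolP (sedge x y); last by rewrite P0 ?Q0.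
  by have := eq_h (Sub (x, y) xy); rewrite !ffunE SubK.
rewrite -(card_in_imset h_inj); apply: eq_card => p; rewrite inE.
apply/imsetP/forallP => [[P /face_potentialsP[_ PI] ->] d|pI].
  by rewrite !ffunE permE /= PI -?surjective_pairing ?(valP d).
pose ext d := if [pick d' : dart G | val d' == d] is Some d' then p d' else 0.
have extE (d : dart G) : ext (val d) = p d.
  by rewrite /ext; case: pickP => [d' /eqP/val_inj->|/(_ d)] //; rewrite eqxx.
exists [ffun d => ext d]; last by apply/ffunP=> d; rewrite !ffunE extE.
apply/face_potentialsP; split=> [x y xy|u v uv]; rewrite !ffunE.
  rewrite /ext; case: pickP => // d /eqP dE.
  by have := valP d; rewrite dE /= (negPf xy).
pose d : dart G := Sub (u, v) uv.
rewrite -[(u, v)]/(val d) -[(v, _)]/(val (face_fun rho d)) !extE.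
by rewrite -[RHS](eqP (pI d)) permE.
Qed.

(** Three times the sum of the contributions z1 w2 - z2 w1 of the vertices, in a
    form that does not single out a dart at each vertex. *)
Definition intersection_form (z w : {ffun G * G -> F}) : F :=
  \sum_v \sum_y (z (v, y) * w (v, succ_at v y) - z (v, succ_at v y) * w (v, y)).

Definition radical : {set {ffun G * G -> F}} :=
  [set z in flows (@sedge G) |
    [forall w in flows (@sedge G), intersection_form z w == 0]].

Hypotheses (G_cubic : cubic G) (G_conn : connected G).

Lemma succ_at3 v y : sedge v y -> succ_at v (succ_at v (succ_at v y)) = y.
Proof.
move=> vy; have := iter_porbit (succ_at v) y.
by rewrite succ_at_orbit // -/(deg v) G_cubic.
Qed.

Lemma sum_star (v y : G) (f : G -> F) : sedge v y ->
  (forall x, ~~ sedge v x -> f x = 0) ->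
  \sum_x f x = f y + f (succ_at v y) + f (succ_at v (succ_at v y)).
Proof.
move=> vy f0; rewrite (bigID (mem (nbrs v))) /= [X in _ + X]big1 ?addr0; last first.
  by move=> x; rewrite inE => /f0.
have U := uniq_traject_porbit (succ_at v) y; have E := porbit_traject (succ_at v) y.
rewrite succ_at_orbit // -/(deg v) G_cubic in U E.
by rewrite (eq_bigl _ _ E) -big_uniq //= !big_cons big_nil addr0 addrA.
Qed.

Lemma exists_nbr v : exists y : G, sedge v y.
Proof.
have : (0 < #|nbrs v|)%N by rewrite -/(deg v) G_cubic.
by case/card_gt0P => y; rewrite inE; exists y.
Qed.

(** A discrete integration by parts: a primitive [q] of [- a] along the rotation
    turns the contribution of [v] to the intersection form into a pairing. *)
Lemma star_intersection (v : G) (q a b : G -> F) :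
  (forall x, ~~ sedge v x -> a x = 0) -> (forall x, ~~ sedge v x -> b x = 0) ->
  \sum_x b x = 0 ->
  (forall x, sedge v x -> q (succ_at v x) = q x - a x) ->
  \sum_x (a x * b (succ_at v x) - a (succ_at v x) * b x) =
  - (3%:R * \sum_x (q x + q (succ_at v x)) * b x).
Proof.
move=> a0 b0 bD qE; have [y vy] := exists_nbr v.
rewrite (sum_star vy) in bD => //.
rewrite !(sum_star vy); first last.
- by move=> x vx; rewrite a0 // succ_at_out // a0 // !mul0r subrr.
- by move=> x vx; rewrite b0 // mulr0.
have vy1 : sedge v (succ_at v y) by rewrite sedge_succ_at.
have vy2 : sedge v (succ_at v (succ_at v y)) by rewrite sedge_succ_at.
have q1 := qE _ vy; have q2 := qE _ vy1; have q3 := qE _ vy2.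
rewrite succ_at3 // in q3 *; rewrite q2 q1 in q3; rewrite q2 q1.
move: (q y) (a y) (a (succ_at v y)) (a (succ_at v (succ_at v y)))
  (b y) (b (succ_at v y)) (b (succ_at v (succ_at v y))) bD q3.
move=> q0 a1 a2 a3 b1 b2 b3 bD q3.
have a3E : a1 + a2 + a3 = 0.
  have -> : a1 + a2 + a3 = q0 - (q0 - a1 - a2 - a3) by ring.
  by rewrite -q3 subrr.
have -> : a3 = - a1 - a2 by rewrite -[LHS]subr0 -a3E; ring.
have -> : b3 = - b1 - b2 by rewrite -[LHS]subr0 -bD; ring.
ring.
Qed.

(** The flow of the boundary of a combination of faces. With [d = (v, u)], face
    invariance reads [P (v, succ_at v u) = P d - face_flow P d], so that [P]
    satisfies the hypothesis of [star_intersection] around each vertex. *)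
Definition face_flow (P : {ffun G * G -> F}) : {ffun G * G -> F} :=
  [ffun d => P d - P (d.2, d.1)].

Lemma face_flow_flow P : P \in face_potentials -> face_flow P \in flows (@sedge G).
Proof.
move=> /face_potentialsP[P0 PI]; apply/flowsP; split=> [x y|x y xy|x].
- by rewrite !ffunE opprB.
- by rewrite !ffunE /= !P0 ?subrr // sedge_sym.
under eq_bigr do rewrite ffunE /=.
rewrite sumrB (reindex_inj (@perm_inj _ (succ_at x))) -sumrB big1 // => y _.
have [yx|yx] := boolP (sedge y x); first by rewrite PI ?subrr.
by rewrite succ_at_out ?P0 ?subrr // sedge_sym.
Qed.

(** By [star_intersection] the form becomes the sum of a symmetric function of
    darts times the antisymmetric [w]. *)
Lemma face_flow_radical P : P \in face_potentials -> face_flow P \in radical.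
Proof.
move=> PP; rewrite inE face_flow_flow //; apply/forall_inP => w.
have /face_potentialsP[P0 PI] := PP.
have /flowsP[zN z0 zD] := face_flow_flow PP.
move=> /flowsP[wN w0 wD]; rewrite /intersection_form.
have E v : \sum_y (face_flow P (v, y) * w (v, succ_at v y) - face_flow P (v, succ_at v y) * w (v, y))
   = - (3%:R * \sum_y (P (v, y) + P (y, v)) * w (v, y)).
  rewrite (@star_intersection v (fun y => P (v, y)) (fun y => face_flow P (v, y)) (fun y => w (v, y))).
  - congr (- (_ * _)); apply: eq_bigr => y _; congr ((_ + _) * _).
    have [vy|vy] := boolP (sedge y v); first by rewrite PI.
    by rewrite succ_at_out ?P0 // sedge_sym.
  - by move=> x; apply: z0.
  - by move=> x; apply: w0.
  - exact: wD.
  - by move=> x vx; rewrite PI 1?sedge_sym // ffunE /=; ring.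
under eq_bigr do rewrite E.
rewrite sumrN -mulr_sumr antisym_sum ?mulr0 ?oppr0 // => x y.
by rewrite [w (x, y)]wN addrC mulrN.
Qed.

(** A face-invariant function with zero flow takes the same value on the two
    orientations of each edge, hence around each vertex, hence everywhere. *)
Lemma face_flow_inj (d0 : G * G) : sedge d0.1 d0.2 ->
  {in face_potentials &, injective (fun P : {ffun G * G -> F} => (P d0, face_flow P))}.
Proof.
move=> d0P P Q /face_potentialsP[P0 PI] /face_potentialsP[Q0 QI] [eq_d0 /ffunP eq_z].
pose r (x y : G) := P (x, y) - Q (x, y).
have rI u v : sedge u v -> r v (succ_at v u) = r u v by move=> uv; rewrite /r PI // QI.
have rS u v : r u v = r v u.
  have := eq_z (u, v); rewrite !ffunE /= => eq_uv.
  by rewrite /r -[P (u, v)](subrK (P (v, u))) eq_uv; ring.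
have r_star v x y : sedge v x -> sedge v y -> r v x = r v y.
  move=> vx; rewrite -[sedge v y]inE -/(nbrs v) -(succ_at_orbit vx).
  case/porbitP => i ->; elim: i => [|i IHi]; first by rewrite perm1.
  rewrite expgSr permM rI; first by rewrite IHi rS.
  rewrite sedge_sym -[sedge _ _]inE -/(nbrs v) -(succ_at_orbit vx).
  exact: mem_porbit.
case: d0 d0P eq_d0 => a b /= ab eq_ab.
have rab : r a b = 0 by rewrite /r eq_ab subrr.
have r0 x y : sedge x y -> r x y = 0.
  have /connectP[p pP ->] := G_conn a x.
  elim: p a b ab rab pP {eq_ab} => [|a' p IHp] a b ab rab /=.
    by move=> _ ay; rewrite (r_star _ _ b).
  case/andP=> aa' pP; apply: (IHp a' a) => //; first by rewrite sedge_sym.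
  by rewrite rS (r_star _ _ b).
apply/ffunP => -[x y]; have [xy|xy] := boolP (sedge x y); last by rewrite P0 ?Q0.
by apply/eqP; rewrite -subr_eq0; apply/eqP/r0.
Qed.

Lemma star_potential (v : G) (a : G -> F) : \sum_x a x = 0 ->
  (forall x, ~~ sedge v x -> a x = 0) ->
  exists q : {ffun G -> F}, forall x, sedge v x -> q (succ_at v x) = q x - a x.
Proof.
move=> aD a0; have [y vy] := exists_nbr v.
have U := uniq_traject_porbit (succ_at v) y; have E := porbit_traject (succ_at v) y.
rewrite succ_at_orbit // -/(deg v) G_cubic /= in U E.
rewrite (sum_star vy) // in aD.
exists [ffun x => if x == y then 0 else if x == succ_at v y then - a y
        else - a y - a (succ_at v y)].
move: U; rewrite !inE negb_or andbT => /andP[/andP[y1 y2] y12] x.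
rewrite -[sedge _ _]inE -/(nbrs v) E !inE !ffunE => /or3P[] /eqP->.
- by rewrite eqxx [_ == y]eq_sym (negPf y1) eqxx sub0r.
- by rewrite [_ == y]eq_sym (negPf y2) [_ == succ_at v y]eq_sym (negPf y12) eq_sym (negPf y1) eqxx.
rewrite succ_at3 // eqxx [_ == y]eq_sym (negPf y2) [_ == succ_at v y]eq_sym (negPf y12).
by rewrite -[LHS]oppr0 -aD; ring.
Qed.

Lemma F5_3 : 3%:R != 0 :> F. Proof. by []. Qed.

(** Every flow [z] has a primitive around each vertex, unique up to a constant.
    That [z] is orthogonal to all flows means that the mismatch of these
    primitives along the edges is a gradient, and subtracting half of its
    potential makes them agree. *)
Lemma radical_face_flow z t d0 : sedge d0.1 d0.2 -> z \in radical ->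
  exists2 P, P \in face_potentials & P d0 = t /\ face_flow P = z.
Proof.
move=> d0P; rewrite inE => /andP[zF /forall_inP zR].
have /flowsP[zN z0 zD] := zF.
have [q qP] := fin_all_exists (fun v => star_potential (zD v) (z0 v)).
pose s (x y : G) := q x y + q x (succ_at x y).
have s_orth w : w \in flows (@sedge G) -> \sum_x \sum_y s x y * w (x, y) = 0.
  move=> wF; have /flowsP[wN w0 wD] := wF; have /eqP := zR w wF; rewrite /intersection_form.
  under eq_bigr => v _ do rewrite
    (@star_intersection v (q v) (fun y => z (v, y)) (fun y => w (v, y)) (z0 v) (w0 v) (wD v) (qP v)).
  by rewrite sumrN -mulr_sumr => /eqP; rewrite oppr_eq0 mulf_eq0 (negPf F5_3) => /eqP.
pose g : {ffun G * G -> F} := [ffun d => s d.1 d.2 - s d.2 d.1].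
have gN x y : g (x, y) = - g (y, x) by rewrite !ffunE opprB.
have gz w : w \in flows (@sedge G) -> pairing g w = 0.
  move=> wF; have /flowsP[wN w0 wD] := wF.
  have -> : pairing g w = \sum_x \sum_y g (x, y) * w (x, y).
    by rewrite pair_bigA; apply: eq_bigr => -[].
  under eq_bigr => x _.
    under eq_bigr => y _ do rewrite ffunE mulrBl /= [in X in _ - X]wN mulrN opprK.
    rewrite big_split /=; over.
  rewrite big_split /= [X in _ + X]exchange_big /=.
  by rewrite !s_orth ?addr0.
have [c cP] := orth_flows_gradient (@sedge_sym G) G_conn gN gz.
pose P0 (x y : G) := q x y - c x / 2%:R.
pose k := t - P0 d0.1 d0.2.
pose P : {ffun G * G -> F} := [ffun d => if sedge d.1 d.2 then P0 d.1 d.2 + k else 0].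
have PI u v : sedge u v -> P (v, succ_at v u) = P (u, v).
  move=> uv; have vu : sedge v u by rewrite sedge_sym.
  rewrite !ffunE /= sedge_succ_at vu uv /P0; congr (_ + _).
  rewrite qP //; apply/eqP; rewrite -subr_eq0; apply/eqP/(mulfI F5_2).
  have := cP _ _ vu; rewrite !ffunE /= /s !qP // [z (u, v)]zN => E.
  have half (a : F) : 2%:R * (a / 2%:R) = a by rewrite mulrC divfK ?F5_2.
  rewrite mulr0 -[RHS](subrr (c v - c u)) -{1}E -[in RHS](half (c v)) -[in RHS](half (c u)).
  by ring.
have PP : P \in face_potentials.
  by apply/face_potentialsP; split=> // x y xy; rewrite ffunE (negPf xy).
exists P => //; split; first by rewrite ffunE d0P /k addrC subrK.
apply/ffunP=> -[x y]; have [xy|xy] := boolP (sedge x y); last first.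
  by have /flowsP[_ -> //] := face_flow_flow PP; rewrite z0.
have yx : sedge y x by rewrite sedge_sym.
by rewrite ffunE /= -[P (y, x)]PI // !ffunE /= sedge_succ_at xy /P0 qP //; ring.
Qed.

(** The functions constant on faces are counted through [face_flow], whose
    kernel consists of the five constants. *)
Lemma card_faces_radical (v : G) : (5 ^ nfaces rho = 5 * #|radical|)%N.
Proof.
have [y vy] := exists_nbr v.
rewrite -card_face_potentials -(card_in_imset (@face_flow_inj (v, y) vy)).
have -> : (5 * #|radical|)%N = #|setX [set: F] radical| by rewrite cardsX cardsT card_F5.
apply: eq_card => -[t z].
rewrite in_setX in_setT /=; apply/imsetP/idP => [[P PP [_ ->]]|zR].
  exact: face_flow_radical.
by have [P PP [<- <-]] := radical_face_flow t (vy : sedge (v, y).1 (v, y).2) zR; exists P.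
Qed.
End Faces.

(** * The genus polynomial as an invariant of the flow space *)

Section TransportRotation.
Variables (G H : sgraph) (b : G -> H) (b' : H -> G).
Variables (h : G -> G -> H) (h' : G -> H -> G).
Hypotheses (bK : cancel b b') (b'K : cancel b' b).
Hypotheses (hK : forall v, cancel (h v) (h' v)) (h'K : forall v, cancel (h' v) (h v)).
Hypothesis hE : forall v y, sedge (b v) (h v y) = sedge v y.

(** The rotation at [b v] is the conjugate by [h v] of the rotation at [v]. *)
Definition transport_fun (rho : rotation G) (w y : H) : H :=
  h (b' w) (succ_at rho (b' w) (h' (b' w) y)).

Lemma transport_fun_inj rho w : injective (transport_fun rho w).
Proof. by move=> y y' /(can_inj (hK _))/perm_inj/(can_inj (h'K _)). Qed.

Definition transport_ffun rho : {ffun H -> {perm H}} :=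
  [ffun w => perm (@transport_fun_inj rho w)].

Lemma transport_ffunE rho v y :
  transport_ffun rho (b v) (h v y) = h v (succ_at rho v y).
Proof. by rewrite ffunE permE /transport_fun bK hK. Qed.

Lemma transport_is_rotation rho : is_rotation (transport_ffun rho).
Proof.
apply/forallP => w; rewrite -[w]b'K; move: (b' w) => v {w}.
have sE y : sedge (b v) y = sedge v (h' v y) by rewrite -hE h'K.
apply/andP; split.
  apply/subsetP => y; rewrite !inE sE; apply: contraR => vy.
  by rewrite -{1}[y](h'K v) transport_ffunE succ_at_out // h'K.
apply/forall_inP => u; rewrite inE sE => vu; apply/eqP/setP => y.
rewrite inE sE -[RHS]inE -/(nbrs v) -(succ_at_orbit rho vu).
have iterE i : (transport_ffun rho (b v) ^+ i)%g u = h v ((succ_at rho v ^+ i)%g (h' v u)).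
  elim: i => [|i IHi]; first by rewrite !perm1 h'K.
  by rewrite !expgSr !permM IHi transport_ffunE.
apply/porbitP/porbitP => -[i E]; exists i; first by rewrite E iterE hK.
by rewrite iterE -E h'K.
Qed.

Definition transport (rho : rotation G) : rotation H := Sub _ (transport_is_rotation rho).

Lemma transportE rho v y : succ_at (transport rho) (b v) (h v y) = h v (succ_at rho v y).
Proof. exact: transport_ffunE. Qed.

Lemma transport_inj : injective transport.
Proof.
move=> r r' eq_r; apply/val_inj/ffunP => v; apply/permP => y.
by apply: (can_inj (hK v)); rewrite -[LHS]transportE eq_r transportE.
Qed.
End TransportRotation.

Lemma signed_minor (s x y x' y' : F) : s * s = 1 ->
  s * x * (s * y) - s * x' * (s * y') = x * y - x' * y'.
Proof. by move=> s2; rewrite -[RHS]mul1r -s2; ring. Qed.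

Section FlowCorrespondence.
Variables (G H : sgraph) (b : G -> H) (h : G -> G -> H).
Variables (T : {ffun H * H -> F} -> {ffun G * G -> F}) (eta : G -> F).
Hypotheses (G_cubic : cubic G) (G_conn : connected G) (H_conn : connected H).
Hypotheses (b_bij : bijective b) (h_bij : forall v, bijective (h v)).
Hypothesis hE : forall v y, sedge (b v) (h v y) = sedge v y.
Hypothesis eta2 : forall v, eta v * eta v = 1.
Hypothesis TE : forall z, z \in flows (@sedge H) ->
  forall v y, T z (v, y) = eta v * z (b v, h v y).
Hypothesis T_im : T @: flows (@sedge H) = flows (@sedge G).

(** Transporting rotations along the [h v] matches the intersection forms, the
    sign [eta v] occurring squared; hence radicals and numbers of faces agree. *)
Theorem genus_poly_flow_correspondence : genus_poly G = genus_poly H.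
Proof.
have [b' bK b'K] := b_bij.
have h_ex v : exists h' : H -> G, cancel (h v) h' /\ cancel h' (h v).
  by have [h' hK h'K] := h_bij v; exists h'.
have [h' h'P] := fin_all_exists h_ex => {h_ex}.
have hK v : cancel (h v) (h' v) by have [] := h'P v.
have h'K v : cancel (h' v) (h v) by have [] := h'P v.
pose R := transport bK b'K hK h'K hE.
have RE rho v y : succ_at (R rho) (b v) (h v y) = h v (succ_at rho v y) by apply: transportE.
have hE' w y : sedge (b' w) (h' (b' w) y) = sedge w y by rewrite -hE b'K h'K.
pose R' := transport b'K bK (fun w => h'K (b' w)) (fun w => hK (b' w)) hE'.
have R_inj : injective R by apply: transport_inj.
have R'_inj : injective R' by apply: transport_inj.
have R_bij : bijective R := inj_card_bij R_inj (leq_card R' R'_inj).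
have cardGH : #|G| = #|H| := bij_eq_card b_bij.
have H_cubic : cubic H.
  move=> w; rewrite -(G_cubic (b' w)) /deg -(card_imset _ (can_inj (hK (b' w)))).
  apply: eq_card => y; rewrite inE; apply/idP/imsetP => [wy|[x vx ->]].
    exists (h' (b' w) y); last by rewrite h'K.
    by rewrite inE -hE h'K b'K.
  by rewrite -[w in sedge w _]b'K hE -[sedge _ _]inE.
have T_inj : {in flows (@sedge H) &, injective T}.
  move=> z z' zF z'F eq_T; apply/ffunP => -[w y].
  rewrite -[w]b'K -[y](h'K (b' w)); set v := b' w; set x := h' v y.
  have := congr1 (fun t : {ffun G * G -> F} => eta v * t (v, x)) eq_T.
  by rewrite !TE // !mulrA eta2 !mul1r.
have interE rho z w : z \in flows (@sedge H) -> w \in flows (@sedge H) ->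
    intersection_form (R rho) z w = intersection_form rho (T z) (T w).
  move=> zF wF; rewrite /intersection_form (reindex b) /=; last exact: onW_bij.
  apply: eq_bigr => v _; rewrite (reindex (h v)) /=; last exact: onW_bij.
  apply: eq_bigr => y _; rewrite RE !TE //.
  exact: (esym (signed_minor _ _ _ _ (eta2 v))).
have nfacesR rho : nfaces (R rho) = nfaces rho.
  have [/eqP|/card_gt0P[v _]] := posnP #|G|.
    rewrite /nfaces => G0.
    have none (K : sgraph) (r : rotation K) : #|K| = 0%N -> #|porbits (face_perm r)| = 0%N.
      move=> K0; apply: eq_card0 => A; apply/negP => /imsetP[[[x y] xy] _ _].
      by have := card0_eq K0 x; rewrite inE.
    by rewrite !none // -?cardGH; apply/eqP.
  apply: (@expnI 5) => //.
  rewrite (card_faces_radical (R rho) H_cubic H_conn (b v)) (card_faces_radical rho G_cubic G_conn v).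
  have sub_rad : {subset radical (R rho) <= flows (@sedge H)}.
    by move=> z; rewrite inE => /andP[].
  congr (_ * _)%N; rewrite -(card_in_imset (sub_in2 sub_rad T_inj)); apply: eq_card => z.
  apply/imsetP/idP => [[z' z'R ->]|]; rewrite inE.
    have z'F := sub_rad _ z'R; move: z'R; rewrite inE z'F /= => /forall_inP z'R.
    apply/andP; split; first by rewrite -T_im; apply: imset_f.
    apply/forall_inP => w; rewrite -T_im => /imsetP[w' w'F ->].
    by rewrite -interE // z'R.
  rewrite -T_im => /andP[/imsetP[z' z'F ->] /forall_inP zR].
  exists z' => //; rewrite inE z'F /=; apply/forall_inP => w wF.
  by rewrite interE // zR // imset_f.
rewrite /genus_poly [RHS](reindex R) /=; last exact: onW_bij.
by apply: eq_bigr => rho _; rewrite /genus nfacesR cardGH.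
Qed.
End FlowCorrespondence.

(** * Balanced Whitney twists *)

Lemma eq_flows (V : finType) (e e' : rel V) : e =2 e' -> flows e = flows e'.
Proof.
by move=> eE; apply/setP => z; apply/flowsP/flowsP => -[zN z0 zD]; split=> // x y xy;
  apply: z0; rewrite ?eE // -eE.
Qed.

Lemma relabel_flow (V W : finType) (e : rel V) (e' : rel W) (t : V -> W) z :
  bijective t -> (forall x y, e' (t x) (t y) = e x y) -> z \in flows e' ->
  [ffun d => z (t d.1, t d.2)] \in flows e.
Proof.
move=> t_bij eE /flowsP[zN z0 zD]; apply/flowsP; split=> [x y|x y xy|x].
- by rewrite !ffunE.
- by rewrite ffunE z0 // eE.
under eq_bigr do rewrite ffunE /=.
by rewrite -[RHS](zD (t x)) [RHS](reindex t) //=; apply: onW_bij.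
Qed.

Lemma genus_poly_iso (G H : sgraph) (t : G -> H) : cubic G -> connected G -> connected H ->
  bijective t -> (forall x y, sedge (t x) (t y) = sedge x y) -> genus_poly G = genus_poly H.
Proof.
move=> G_cubic G_conn H_conn t_bij tE.
apply: (@genus_poly_flow_correspondence G H t (fun=> t)
  (fun z => [ffun d => z (t d.1, t d.2)]) (fun=> 1)) => //.
- by move=> v; rewrite mulr1.
- by move=> z zF v y; rewrite ffunE mul1r.
apply/setP => z; apply/imsetP/idP => [[z' z'F ->]|zF].
  exact: relabel_flow z'F.
have [t' tK t'K] := t_bij.
exists [ffun d => z (t' d.1, t' d.2)].
  apply: relabel_flow zF; first by exists t.
  by move=> x y; rewrite -tE !t'K.
by apply/ffunP => -[x y]; rewrite !ffunE /= !tK.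
Qed.

Section TwistFlow.
Variables (V : finType) (u v : V).
Local Notation tau := (tperm u v).

(** With [a] the adjacency of the side A, the adjacency of A in the twisted graph. *)
Definition swap_ends (a : rel V) : rel V := [rel x y | a (tau x) (tau y)].

(** The flow is kept on the side B and negated on the side A. The negation
    compensates for the exchange of the ends of A, because the flows that enter
    A at the two ends add up to zero. *)
Definition twist_flow (a b : rel V) (z : {ffun V * V -> F}) : {ffun V * V -> F} :=
  [ffun d => (b d.1 d.2)%:R * z d -
             (swap_ends a d.1 d.2)%:R * z (tau d.1, tau d.2)].

Lemma swap_endsK a : swap_ends (swap_ends a) =2 a.
Proof. by move=> x y; rewrite /swap_ends /= !tpermK. Qed.

(** All that the flow computation needs from a Whitney separation. Unlike the
    separation itself it is inherited by the swapped side ([swap_separated]), so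
    that twisting back is an instance of the same construction. *)
Definition separated (a b : rel V) : Prop :=
  [/\ symmetric a, symmetric b, irreflexive a, forall x y, a x y -> ~~ b x y
    & forall x y y', x != u -> x != v -> a x y -> ~~ b x y'].

Lemma tau_ends x : (x == u) || (x == v) -> tau x = if x == u then v else u.
Proof. by case: eqP => [->|_ /= /eqP->]; rewrite ?tpermL ?tpermR. Qed.

Lemma swap_ends_sym a : symmetric a -> symmetric (swap_ends a).
Proof. by move=> aC x y; rewrite /swap_ends /= aC. Qed.

Lemma swap_ends_disjoint a b x y : separated a b -> swap_ends a x y -> ~~ b x y.
Proof.
rewrite /swap_ends; case=> aC bC a0 ab sepP /=.
have out s t : s != u -> s != v -> a (tau s) (tau t) -> ~~ b s t.
  by move=> su sv; rewrite (tpermD (z := s)) 1?eq_sym // => /sepP; apply.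
have [xI|] := boolP ((x == u) || (x == v)); last by rewrite negb_or => /andP[]; apply: out.
have [yI|] := boolP ((y == u) || (y == v)); last first.
  by rewrite negb_or aC bC => /andP[]; apply: out.
rewrite !tau_ends //.
case/orP: xI => /eqP->; case/orP: yI => /eqP->; rewrite ?eqxx ?a0 //; case: eqP => [->|_]; rewrite ?a0 //.
  by rewrite aC; apply: ab.
by rewrite aC; apply: ab.
Qed.

Lemma swap_separated a b : separated a b -> separated (swap_ends a) b.
Proof.
move=> sep; have [aC bC a0 ab sepP] := sep; split=> //.
- exact: swap_ends_sym.
- by move=> x; rewrite /swap_ends /= a0.
- by move=> x y; apply: swap_ends_disjoint.
- move=> x y y' xu xv; rewrite /swap_ends /= (tpermD (z := x)) 1?eq_sym //; exact: sepP.
Qed.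

Section Separated.
Variables (a b : rel V).
Hypothesis sep : separated a b.
Variable z : {ffun V * V -> F}.
Hypothesis zF : z \in flows [rel x y | a x y || b x y].

Definition side_out (a : rel V) (x : V) : F := \sum_y (a x y)%:R * z (x, y).

Lemma side_out_add x : side_out a x + side_out b x = 0.
Proof.
have /flowsP[zN z0 zD] := zF; have [aC bC a0 ab sepP] := sep.
rewrite -[RHS](zD x) /side_out -big_split; apply: eq_bigr => y _ /=.
have [axy|axy] := boolP (a x y); first by rewrite (negPf (ab _ _ axy)) mul1r mul0r addr0.
have [bxy|bxy] := boolP (b x y); first by rewrite mul1r mul0r add0r.
by rewrite z0 /= ?negb_or ?axy // !mul0r addr0.
Qed.

Lemma side_out_inner x : x != u -> x != v -> side_out a x = 0 /\ side_out b x = 0.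
Proof.
move=> xu xv; have [aC bC a0 ab sepP] := sep.
have [/existsP[y axy]|] := boolP [exists y, a x y].
  have b0 : side_out b x = 0.
    by apply: big1 => y' _; rewrite (negPf (sepP _ _ _ xu xv axy)) mul0r.
  by have := side_out_add x; rewrite b0 addr0.
rewrite negb_exists => /forallP na.
have A0 : side_out a x = 0 by apply: big1 => y _; rewrite (negPf (na y)) mul0r.
by have := side_out_add x; rewrite A0 add0r.
Qed.

(** The net outflow of the side [a] vanishes at every other vertex, and so does
    its sum over all vertices. *)
Lemma side_out_ends : u != v -> side_out a u + side_out a v = 0.
Proof.
move=> uv; have /flowsP[zN z0 zD] := zF; have [aC bC a0 ab sepP] := sep.
have <- : \sum_x side_out a x = 0.
  by apply: antisym_sum => x y; rewrite aC zN mulrN.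
rewrite (bigD1 u) // (bigD1 v) 1?eq_sym //= [X in _ + (_ + X)]big1 ?addr0 //.
by move=> x /andP[xu xv]; have [] := side_out_inner xu xv.
Qed.

Lemma twist_flow_flow : u != v ->
  twist_flow a b z \in flows [rel x y | b x y || swap_ends a x y].
Proof.
move=> uv; have /flowsP[zN z0 zD] := zF; have [aC bC a0 ab sepP] := sep.
apply/flowsP; split=> [x y|x y|x].
- by rewrite !ffunE /swap_ends /= bC aC [z (x, y)]zN [z (tau x, _)]zN; ring.
- by rewrite ffunE /= negb_or => /andP[/negPf-> /negPf->]; rewrite !mul0r subrr.
under eq_bigr do rewrite ffunE /=.
rewrite sumrB -/(side_out b x).
rewrite [X in _ - X](_ : _ = side_out a (tau x)); last first.
  rewrite /side_out [RHS](reindex_inj (@perm_inj _ tau)).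
  by apply: eq_bigr => y _.
have ends : side_out a u + side_out a v = 0 := side_out_ends uv.
have bE y : side_out b y = - side_out a y.
  by apply/eqP; rewrite -addr_eq0 addrC side_out_add.
case: (tpermP u v x) => [->|->|/eqP xu /eqP xv].
- by rewrite bE -opprD ends oppr0.
- by rewrite bE -opprD addrC ends oppr0.
- by have [-> ->] := side_out_inner xu xv; rewrite subrr.
Qed.

Lemma twist_flowK : twist_flow (swap_ends a) b (twist_flow a b z) = z.
Proof.
have /flowsP[zN z0 zD] := zF; have [aC bC a0 ab sepP] := sep.
apply/ffunP => -[x y]; rewrite !ffunE /swap_ends /= !tpermK.
have D1 : b x y -> ~~ a (tau x) (tau y).
  by move=> bxy; apply/negP => /(swap_ends_disjoint sep); rewrite bxy.
have D2 : a x y -> ~~ b (tau x) (tau y).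
  by move=> axy; apply: (swap_ends_disjoint sep); rewrite /swap_ends /= !tpermK.
have [axy|axy] := boolP (a x y); first by
  rewrite (negPf (ab _ _ axy)) (negPf (D2 axy)) !mul0r !mul1r !sub0r opprK.
have [bxy|bxy] := boolP (b x y); first by rewrite (negPf (D1 bxy)) !mul0r !mul1r !subr0.
by rewrite z0 /= ?negb_or ?axy // !mul0r subrr.
Qed.
End Separated.
End TwistFlow.

Section Twisting.
Variables (G : sgraph) (A B : subgraph G) (u v : G).
Hypothesis ws : whitney_separation A B u v.
Local Notation a := (sub_adj A).
Local Notation b := (sub_adj B).
Local Notation tau := (tperm u v).
Local Notation H := (whitney_twist A B u v).

Lemma sub_adj_sym (C : subgraph G) : symmetric (sub_adj C).
Proof. by move=> x y; rewrite /sub_adj /= setUC. Qed.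

Lemma whitney_uv : u != v. Proof. by case: ws. Qed.

Lemma whitney_sedge x y : sedge x y = a x y || b x y.
Proof. by case: ws => _ AB _ _ _; rewrite -edge_setP -AB inE. Qed.

Lemma whitney_separated : separated u v a b.
Proof.
case: ws => uv AB dis VAB _.
have vert (C : subgraph G) x y : sub_adj C x y -> x \in sub_vert C.
  by move=> /sub_edgeV/subsetP/(_ x); rewrite !inE eqxx; apply.
split; [exact: sub_adj_sym | exact: sub_adj_sym | | |].
- by move=> x; apply/negP => /sub_adjW; rewrite sedge_irrefl.
- by move=> x y axy; apply/negP => bxy; have := disjointFr dis axy; rewrite [_ \in _]bxy.
- move=> x y y' xu xv axy; apply/negP => bxy.
  have : x \in sub_vert A :&: sub_vert B by rewrite inE (vert _ _ _ axy) (vert _ _ _ bxy).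
  by rewrite VAB !inE (negPf xu) (negPf xv).
Qed.

Lemma whitney_twist_sedge (x y : G) : @sedge H x y = b x y || swap_ends u v a x y.
Proof. by []. Qed.

Lemma whitney_twist_connected : connected G -> connected H.
Proof.
move=> G_conn; have H_sym := sym_connect_sym (@sedge_sym H).
have uv_H : connect (@sedge H) u v.
  case: ws => _ _ _ _ [_]; apply: connect_sub => s t bst; apply: connect1.
  by rewrite whitney_twist_sedge bst.
have tau_H s : connect (@sedge H) s (tau s).
  by case: tpermP => [->|->|_ _]; rewrite // H_sym.
move=> x y; apply: connect_sub (G_conn x y) => s t.
rewrite whitney_sedge => /orP[ast|bst]; last first.
  by apply: connect1; rewrite whitney_twist_sedge bst.
apply: connect_trans (tau_H s) _; rewrite H_sym; apply: connect_trans (tau_H t) _.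
by rewrite H_sym; apply: connect1; rewrite whitney_twist_sedge /swap_ends /= !tpermK ast orbT.
Qed.

Definition sub_deg (C : subgraph G) (x : G) : nat := #|[set y | sub_adj C x y]|.

Lemma deg_whitney x : deg x = (sub_deg A x + sub_deg B x)%N.
Proof.
have [_ _ _ ab _] := whitney_separated.
rewrite /deg /sub_deg -cardsUI [X in (_ + X)%N](_ : _ = 0%N) ?addn0.
  by apply: eq_card => y; rewrite !inE whitney_sedge.
apply: eq_card0 => y; rewrite !inE.
by case: (boolP (a x y)) => // /ab/negPf->.
Qed.

Lemma deg_whitney_twist x : @deg H x = (sub_deg A (tau x) + sub_deg B x)%N.
Proof.
have -> : sub_deg A (tau x) = #|[set y | swap_ends u v a x y]|.
  rewrite /sub_deg -(card_preimset _ (@perm_inj _ tau)).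
  by apply: eq_card => y; rewrite !inE.
rewrite /deg /sub_deg -cardsUI [X in (_ + X)%N](_ : _ = 0%N) ?addn0.
  by apply: eq_card => y; rewrite !inE whitney_twist_sedge orbC.
apply: eq_card0 => y; rewrite !inE.
case: (boolP (swap_ends u v a x y)) => // /(swap_ends_disjoint whitney_separated).
by move/negPf->.
Qed.

Lemma sub_deg_gt0 (C : subgraph G) (x y : G) : x != y -> connect (sub_adj C) x y ->
  (0 < sub_deg C x)%N.
Proof.
move=> xy /connectP[[|t p] /=]; first by move=> _ yx; rewrite yx eqxx in xy.
by case/andP=> xt _ _; apply/card_gt0P; exists t; rewrite inE.
Qed.

(** At an end [p] of the separation whose only edge in A leads to [ap], the twist
    exchanges this neighbour with the image of the neighbour [aq] of the other
    end [q]. The flow value is preserved because the values at the two ends are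
    opposite and the twist negates them. *)
Lemma twist_end p q ap aq (z : {ffun G * G -> F}) :
  tau p = q -> (forall y, a p y = (y == ap)) -> (forall y, a q y = (y == aq)) ->
  z \in flows (@sedge H) -> side_out z (swap_ends u v a) p + side_out z (swap_ends u v a) q = 0 ->
  (forall y, @sedge H p (tperm ap (tau aq) y) = @sedge G p y) /\
  (forall y, twist_flow u v (swap_ends u v a) b z (p, y) = z (p, tperm ap (tau aq) y)).
Proof.
move=> pq apE aqE zF ends.
have [aC bC a0 ab _] := whitney_separated.
have HE y : @sedge H p y = b p y || (y == tau aq).
  by rewrite whitney_twist_sedge /swap_ends /= pq aqE (can2_eq (tpermK u v) (tpermK u v)).
have b_ap : b p ap = false by apply/negbTE/ab; rewrite apE.
have b_aq : b p (tau aq) = false.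
  apply/negbTE/(swap_ends_disjoint whitney_separated).
  by rewrite /swap_ends /= pq tpermK aqE.
have qp : tau q = p by rewrite -pq tpermK.
have out1 : side_out z (swap_ends u v a) p = z (p, tau aq).
  rewrite /side_out -[RHS](sum_delta (tau aq) (fun y => z (p, y))).
  by apply: eq_bigr => y _; rewrite /swap_ends /= pq aqE (can2_eq (tpermK u v) (tpermK u v)).
have out2 : side_out z (swap_ends u v a) q = z (q, tau ap).
  rewrite /side_out -[RHS](sum_delta (tau ap) (fun y => z (q, y))).
  by apply: eq_bigr => y _; rewrite /swap_ends /= qp apE (can2_eq (tpermK u v) (tpermK u v)).
have /flowsP[zN z0 zD] := zF.
have cases y : [\/ y = ap /\ tperm ap (tau aq) y = tau aq,
    [/\ y = tau aq, y != ap & tperm ap (tau aq) y = ap] |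
    [/\ y != ap, y != tau aq & tperm ap (tau aq) y = y]].
  have [->|y1] := eqVneq y ap; first by constructor 1; rewrite tpermL.
  have [yE|y2] := eqVneq y (tau aq); first by constructor 2; rewrite yE tpermR -yE.
  by constructor 3; rewrite tpermD // eq_sym.
split=> y.
  rewrite HE whitney_sedge apE.
  case: (cases y) => [[-> ->]|[-> ne ->]|[/negPf y1 /negPf y2 ->]].
  - by rewrite !eqxx orbT.
  - by rewrite b_ap b_aq orbF eq_sym.
  - by rewrite y1 y2 orbF.
rewrite ffunE /swap_ends /= !tpermK apE pq.
case: (cases y) => [[-> ->]|[-> ne ->]|[/negPf y1 /negPf y2 ->]].
- rewrite b_ap eqxx mul0r mul1r sub0r -out1 -[LHS]addr0 -ends out2.
  by rewrite addrCA addNr addr0.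
- by rewrite b_aq (negPf ne) !mul0r subr0 z0 // HE b_ap eq_sym.
- rewrite y1 mul0r subr0; have [byp|byp] := boolP (b p y); first by rewrite mul1r.
  by rewrite mul0r z0 // HE (negPf byp) y2.
Qed.

Lemma twist_inner x : x != u -> x != v -> (exists y, a x y) ->
  (forall y, @sedge H x (tau y) = @sedge G x y) /\
  (forall z, z \in flows (@sedge H) ->
   forall y, twist_flow u v (swap_ends u v a) b z (x, y) = - z (x, tau y)).
Proof.
move=> xu xv [t axt]; have [aC bC a0 ab sepP] := whitney_separated.
have tx : tau x = x by rewrite tpermD // eq_sym.
have bx y : b x y = false by apply/negbTE/(sepP _ _ _ xu xv axt).
have HE y : @sedge H x (tau y) = sedge x y.
  by rewrite whitney_twist_sedge whitney_sedge /swap_ends /= tx tpermK !bx orbF.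
split=> // z /flowsP[zN z0 zD] y; rewrite ffunE /swap_ends /= !tpermK tx bx mul0r sub0r.
have [axy|axy] := boolP (a x y); first by rewrite mul1r.
by rewrite mul0r z0 // HE whitney_sedge bx (negPf axy).
Qed.

Lemma twist_outer x : x != u -> x != v -> (forall y, ~~ a x y) ->
  (forall y, @sedge H x y = @sedge G x y) /\
  (forall z, z \in flows (@sedge H) ->
   forall y, twist_flow u v (swap_ends u v a) b z (x, y) = z (x, y)).
Proof.
move=> xu xv na; have tx : tau x = x by rewrite tpermD // eq_sym.
have HE y : @sedge H x y = b x y.
  by rewrite whitney_twist_sedge /swap_ends /= tx (negPf (na _)) orbF.
split=> [y|z /flowsP[zN z0 zD] y]; first by rewrite HE whitney_sedge (negPf (na _)).
rewrite ffunE /swap_ends /= !tpermK (negPf (na _)) mul0r subr0.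
have [bxy|bxy] := boolP (b x y); first by rewrite mul1r.
by rewrite mul0r z0 // HE.
Qed.

Lemma twist_flow_im : twist_flow u v (swap_ends u v a) b @: flows (@sedge H) = flows (@sedge G).
Proof.
have sepA := whitney_separated; have sepA' := swap_separated sepA.
have HE : flows (@sedge H) = flows [rel x y | swap_ends u v a x y || b x y].
  by apply: eq_flows => x y; rewrite whitney_twist_sedge orbC.
have GE : flows (@sedge G) = flows [rel x y | a x y || b x y].
  by apply: eq_flows => x y; rewrite whitney_sedge.
apply/setP => z; apply/imsetP/idP => [[z' z'H ->]|zG].
  rewrite HE in z'H; have := twist_flow_flow sepA' z'H whitney_uv.
  rewrite GE (eq_flows (e' := [rel x y | a x y || b x y])) // => x y.
  by rewrite /= swap_endsK orbC.
rewrite GE in zG; exists (twist_flow u v a b z).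
  by have := twist_flow_flow sepA zG whitney_uv.
by rewrite (twist_flowK sepA zG).
Qed.

(** The sign at a vertex is -1 inside A and 1 at the two ends and in B. *)
Lemma genus_poly_twist1 : cubic G -> connected G -> sub_deg A u = 1%N -> sub_deg A v = 1%N ->
  genus_poly G = genus_poly H.
Proof.
move=> G_cubic G_conn du dv.
have nbr1 x : sub_deg A x = 1%N -> exists s, forall y, a x y = (y == s).
  by move/eqP/cards1P => [s /setP sE]; exists s => y; have := sE y; rewrite !inE.
have [au auE] := nbr1 _ du; have [av avE] := nbr1 _ dv => {nbr1}.
have uv := whitney_uv; have vu : v != u by rewrite eq_sym.
pose h (x : G) : {perm G} := if x == u then tperm au (tau av)
  else if x == v then tperm av (tau au)
  else if [exists y, a x y] then tau else 1%g.
pose eta (x : G) : F := if (x != u) && (x != v) && [exists y, a x y] then - 1 else 1.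
have sepA' := swap_separated whitney_separated.
have ends z : z \in flows (@sedge H) ->
    side_out z (swap_ends u v a) u + side_out z (swap_ends u v a) v = 0.
  have HE : flows (@sedge H) = flows [rel x y | swap_ends u v a x y || b x y].
    by apply: eq_flows => x y; rewrite whitney_twist_sedge orbC.
  by rewrite HE => zF; apply: (side_out_ends sepA' zF uv).
have local (x : G) : (forall y : G, @sedge H x (h x y) = @sedge G x y) /\
    (forall z, z \in flows (@sedge H) ->
     forall y, twist_flow u v (swap_ends u v a) b z (x, y) = eta x * z (x, h x y)).
  rewrite /h /eta; have [->|xu] := eqVneq x u.
    split=> [y|z zF y]; first by
      have [E _] := twist_end (tpermL u v) auE avE (flows0 _) (ends _ (flows0 _)); apply: E.
    by rewrite /= mul1r; have [_ E] := twist_end (tpermL u v) auE avE zF (ends z zF); apply: E.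
  have [->|xv] := eqVneq x v.
    have ends' z zF := etrans (addrC _ _) (ends z zF).
    split=> [y|z zF y]; first by
      have [E _] := twist_end (tpermR u v) avE auE (flows0 _) (ends' _ (flows0 _)); apply: E.
    by rewrite ?andbF /= mul1r; have [_ E] := twist_end (tpermR u v) avE auE zF (ends' z zF); apply: E.
  case: ifP => [/existsP ax|/negbT].
    have [E1 E2] := twist_inner xu xv ax.
    by split=> // z zF y; rewrite E2 // mulN1r.
  rewrite negb_exists => /forallP ax; have [E1 E2] := twist_outer xu xv ax.
  by split=> [y|z zF y]; rewrite perm1 ?E1 // E2 // mul1r.
apply: (@genus_poly_flow_correspondence G H id (fun x => h x)
  (twist_flow u v (swap_ends u v a) b) eta) => //.
- exact: whitney_twist_connected.
- by exists id.
- by move=> x; exists ((h x)^-1)%g; [apply: permK | apply: permKV].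
- by move=> x y; have [E _] := local x; apply: E.
- by move=> x; rewrite /eta; case: ifP; rewrite ?mulrNN mulr1.
- by move=> z zF x y; have [_ E] := local x; apply: E.
- exact: twist_flow_im.
Qed.
End Twisting.

(** A balanced twist has as many edges of A at [u] as at [v]; if there are two,
    there is one edge of B at each, and twisting B gives a graph isomorphic to
    the twist of A by the exchange of [u] and [v]. *)
Theorem genus_poly_balanced_twist (G : sgraph) (A B : subgraph G) (u v : G) :
  connected G -> cubic G -> whitney_separation A B u v -> balanced_twist A B u v ->
  genus_poly G = genus_poly (whitney_twist A B u v).
Proof.
move=> G_conn G_cubic ws [du dv].
have [uv AB dis VAB [cA cB]] := ws.
have ws' : whitney_separation B A u v.
  by split=> //; [rewrite setUC | rewrite disjoint_sym | rewrite setIC].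
rewrite (deg_whitney_twist ws) tpermL (deg_whitney ws) in du.
have dAv : sub_deg A v = sub_deg A u by apply/eqP; rewrite -(eqn_add2r (sub_deg B u)) du.
have := G_cubic u; have := G_cubic v; rewrite !(deg_whitney ws) dAv => dBv dBu.
have dB : sub_deg B v = sub_deg B u by apply/eqP; rewrite -(eqn_add2l (sub_deg A u)) dBv dBu.
have A0 := sub_deg_gt0 uv cA; have B0 := sub_deg_gt0 uv cB.
have [dA1|dA1] := eqVneq (sub_deg A u) 1%N.
  by apply: genus_poly_twist1 => //; rewrite dAv.
have dB1 : sub_deg B u = 1%N.
  by move: dBu A0 B0 dA1; case: (sub_deg A u) => [|[|[|[|]]]] //; case: (sub_deg B u) => [|[|[|]]].
rewrite (genus_poly_twist1 ws' G_cubic G_conn dB1 (etrans dB dB1)).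
pose t : whitney_twist B A u v -> whitney_twist A B u v := tperm u v.
apply: (@genus_poly_iso _ _ t).
- move=> x; rewrite (deg_whitney_twist ws').
  by case: tpermP => [->|->|_ _]; rewrite ?dB -?dB addnC ?dAv -?dAv -(deg_whitney ws) G_cubic.
- exact: whitney_twist_connected ws' G_conn.
- exact: whitney_twist_connected ws G_conn.
- by exists t; apply: tpermK.
- move=> x y; rewrite (whitney_twist_sedge A B u v) (whitney_twist_sedge B A u v).
  by rewrite /swap_ends /t /= !tpermK orbC.
Qed.

(** * Lifting a cycle matroid isomorphism to flows *)

Lemma sign_cases (s : F) : s * s = 1 -> s = 1 \/ s = - 1.
Proof. by move=> s2; have /eqP := s2; rewrite -expr2 sqrf_eq1 => /orP[] /eqP; [left | right]. Qed.

Lemma set2_eq (V : finType) (a b x y : V) : [set a; b] = [set x; y] ->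
  (a = x /\ b = y) \/ (a = y /\ b = x).
Proof.
move=> /setP E; have := E a; have := E b; have := E x; have := E y.
rewrite !inE !eqxx !orbT /= => /orP[] /eqP y1 /orP[] /eqP x1
  /esym/orP[] /eqP b1 /esym/orP[] /eqP a1;
  by subst; auto.
Qed.

Section GraphFlows.
Variable H : sgraph.

Lemma cut_flow (X : {set H}) z : z \in flows (@sedge H) ->
  \sum_(p | (p.1 \in X) && (p.2 \notin X)) z p = 0.
Proof.
move=> /flowsP[zN z0 zD].
have pairE (k : H * H -> F) : \sum_p k p = \sum_x \sum_y k (x, y).
  by rewrite pair_bigA; apply: eq_bigr => -[].
have tot : \sum_(p : H * H | p.1 \in X) z p = 0.
  rewrite big_mkcond pairE big1 // => x _ /=.
  by case: (x \in X); rewrite ?zD // big1.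
have inn : \sum_(p : H * H | (p.1 \in X) && (p.2 \in X)) z p = 0.
  rewrite big_mkcond pairE; apply: antisym_sum => x y /=.
  by rewrite andbC; case: ifP => _; rewrite ?oppr0.
by move: tot; rewrite (bigID (fun p : H * H => p.2 \in X)) /= inn add0r.
Qed.

Lemma flow_two_cut (X : {set H}) (a b x y : H) : sedge a b -> sedge x y ->
  a \in X -> b \notin X -> x \in X -> y \notin X -> (a, b) != (x, y) ->
  (forall e, e \in cut X -> val e = [set a; b] \/ val e = [set x; y]) ->
  forall z, z \in flows (@sedge H) -> z (a, b) = - z (x, y).
Proof.
move=> ab xy aX bX xX yX ne only z zF; have /flowsP[zN z0 zD] := zF.
have := cut_flow X zF; rewrite (bigD1 (a, b)) /= ?aX // (bigD1 (x, y)) /= ?xX ?yX /= 1?eq_sym //.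
rewrite big1 ?addr0; first by move/eqP; rewrite addr_eq0 => /eqP.
move=> [s t] /= /andP[/andP[/andP[sX tX] st_ab] st_xy].
have [st|] := boolP (sedge s t); last exact: z0.
have [e eE] := edge_ex st.
have /only : e \in cut X by rewrite (mem_cut _ eE) sX.
rewrite eE => -[] /set2_eq[] [sE tE]; subst s t; rewrite ?eqxx // in st_ab st_xy *.
  by rewrite sX in bX.
by rewrite sX in yX.
Qed.

Lemma series_flow (g g' : edge H) (a b x y : H) : series g g' ->
  val g = [set a; b] -> val g' = [set x; y] ->
  exists2 s : F, s * s = 1 & forall z, z \in flows (@sedge H) -> z (a, b) = s * z (x, y).
Proof.
move=> gg' gE g'E.
have sgn1 : (1 : F) * 1 = 1 by rewrite mulr1.
have sgn2 : (- 1 : F) * - 1 = 1 by rewrite mulrNN mulr1.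
have [eq_g|ne] := eqVneq g g'.
  rewrite -eq_g gE in g'E; case: (set2_eq g'E) => -[-> ->].
    by exists 1 => // z _; rewrite mul1r.
  by exists (- 1) => // z /flowsP[zN _ _]; rewrite mulN1r; apply: zN.
have /existsP[X /eqP XE] := gg'.
have only e : e \in cut X -> val e = [set a; b] \/ val e = [set x; y].
  rewrite -XE !inE -gE -g'E; case: (eqVneq e g) => [->|_]; first by left.
  by case: (eqVneq e g') => [->|] //; right.
have gc : g \in cut X by rewrite -XE !inE eqxx (negPf ne).
have g'c : g' \in cut X by rewrite -XE !inE eqxx eq_sym (negPf ne).
have ends (k : edge H) s t : val k = [set s; t] -> sedge s t.
  by move=> kE; rewrite -edge_setP -kE (valP k).
have ab := ends _ _ _ gE; have xy := ends _ _ _ g'E.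
have neP : [set a; b] != [set x; y] by rewrite -gE -g'E (inj_eq val_inj).
rewrite (mem_cut _ gE) in gc; rewrite (mem_cut _ g'E) in g'c.
have ab' : [set b; a] = [set a; b] by rewrite setUC.
have xy' : [set y; x] = [set x; y] by rewrite setUC.
have [ba yx] : sedge b a /\ sedge y x by rewrite ![sedge _ a]sedge_sym ![sedge y _]sedge_sym.
have pne s t s' t' : [set s; t] = [set a; b] -> [set s'; t'] = [set x; y] -> (s, t) != (s', t').
  by move=> E E'; apply: contra neP => /eqP[sE tE]; rewrite -E -E' sE tE.
have flip z s t : z \in flows (@sedge H) -> z (s, t) = - z (t, s) by move=> /flowsP[].
case: (boolP (a \in X)) gc => [aX|aX] /= bX; case: (boolP (x \in X)) g'c => [xX|xX] /= yX.
- exists (- 1) => // z zF; rewrite mulN1r.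
  exact: (flow_two_cut ab xy aX bX xX yX (pne _ _ _ _ erefl erefl) only zF).
- exists 1 => // z zF; rewrite mul1r [RHS]flip //.
  by apply: (flow_two_cut ab yx aX bX yX xX (pne _ _ _ _ erefl xy') _ zF); rewrite xy'.
- exists 1 => // z zF; rewrite mul1r flip //; apply/eqP; rewrite eqr_oppLR; apply/eqP.
  by apply: (flow_two_cut ba xy bX aX xX yX (pne _ _ _ _ ab' erefl) _ zF); rewrite ab'.
- exists (- 1) => // z zF; rewrite mulN1r flip // [z (x, y)]flip //; congr (- _).
  by apply: (flow_two_cut ba yx bX aX yX xX (pne _ _ _ _ ab' xy') _ zF); rewrite ab' xy'.
Qed.

(** If every flow vanished on an edge, a unit along this edge would be a
    gradient, and a level set of its potential would exhibit a bridge. *)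
Lemma edge_flow (x y : H) : bridgeless H -> connected H -> sedge x y ->
  exists2 z, z \in flows (@sedge H) & z (x, y) != 0.
Proof.
move=> H_bridgeless H_conn xy; have [/exists_inP//|] :=
  boolP [exists z in flows (@sedge H), z (x, y) != 0].
rewrite negb_exists_in => /forall_inP zxy.
have [c cE] : exists c : {ffun H -> F}, forall s t, sedge s t ->
    unit_flow x y (s, t) = c s - c t.
  apply: (orth_flows_gradient (@sedge_sym H) H_conn (unit_flowN x y)) => z zF.
  have -> : pairing (unit_flow x y) z = pairing z (unit_flow x y).
    by apply: eq_bigr => d _; rewrite mulrC.
  have /flowsP[zN _ _] := zF.
  by rewrite pairing_unit_flow [z (y, x)]zN (eqP (negbNE (zxy z zF))) oppr0 subrr.
have [e eE] := edge_ex xy.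
case/negP: (H_bridgeless e); apply/existsP; exists [set s | c s == c x].
have yx : y != x by apply: contraTneq xy => ->; rewrite sedge_irrefl.
apply/eqP/setP => g; rewrite inE; have [s [t [st gE]]] := edge_ends g.
rewrite (mem_cut _ gE) !inE.
have [gg|ne] := eqVneq g e.
  have cxy : c x - c y != 0.
    by rewrite -cE // ffunE eqxx xpair_eqE [x == y]eq_sym (negPf yx) subr0.
  have cyx : (c y == c x) = false by apply/negbTE; rewrite eq_sym -subr_eq0.
  by rewrite gg eE in gE; case: (set2_eq gE) => -[<- <-]; rewrite eqxx cyx.
have : unit_flow x y (s, t) = 0.
  have ne' : [set s; t] != [set x; y] by rewrite -gE -eE (inj_eq val_inj).
  rewrite ffunE.
  have /negPf-> : (s, t) != (x, y) by apply: contra ne' => /eqP[-> ->].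
  have /negPf-> : (s, t) != (y, x) by apply: contra ne' => /eqP[-> ->]; rewrite setUC.
  by rewrite subrr.
by rewrite cE // => /eqP; rewrite subr_eq0 => /eqP->; rewrite addbb.
Qed.
End GraphFlows.

(** There are more unknowns than equations. The constant term is
    what allows as many sets as points: later only differences of the relation
    at two points matter. *)
Lemma indicator_relation (V W : finType) (X : V -> {set W}) : (#|W| <= #|V|)%N ->
  exists2 t : {ffun option V -> F}, t != 0 &
    forall x, t None + \sum_v t (Some v) * (x \in X v)%:R = 0.
Proof.
move=> WV; pose L (c : {ffun option V -> F}) : {ffun W -> F} :=
  [ffun x => c None + \sum_v c (Some v) * (x \in X v)%:R].
have /injectivePn[c [c' ne eq_L]] : ~~ injectiveb L.
  apply/injectiveP => /leq_card; rewrite !card_ffun card_F5 card_option.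
  by rewrite leq_exp2l // leqNgt ltnS WV.
exists (c - c'); first by rewrite subr_eq0.
move=> x; have /ffunP/(_ x) := eq_L; rewrite !ffunE => eq_x.
under eq_bigr do rewrite !ffunE mulrBl.
rewrite sumrB addrACA -opprD; apply/eqP; rewrite subr_eq0; exact/eqP.
Qed.

Section SignLift.
Variables (G H : sgraph) (f : edge G -> edge H).
Hypotheses (f_bij : bijective f) (G_conn : connected G) (HG : (#|H| <= #|G|)%N) (h0 : H).
Hypothesis f_cut : forall D : {set edge G}, is_cut D -> is_cut (f @: D).

(** Each edge [e = vw] lies in the stars of [v] and [w] only, so that the relation
    among the images [cut (X u)] of the stars, taken along [f e], involves only
    the coefficients of [v] and [w] and makes them equal up to sign. By
    connectivity all coefficients are equal up to sign, and nonzero. *)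
Lemma signed_star_cuts : exists (X : G -> {set H}) (t : G -> F),
  [/\ forall v, f @: star v = cut (X v), forall v, t v * t v = 1
    & forall (e : edge G) v w x y, val e = [set v; w] -> val (f e) = [set x; y] ->
      t v * ((x \in X v)%:R - (y \in X v)%:R) +
      t w * ((x \in X w)%:R - (y \in X w)%:R) = 0].
Proof.
have f_inj := bij_inj f_bij.
have ex v : exists X : {set H}, f @: star v = cut X.
  by have /existsP[X /eqP XE] := f_cut (is_cut_star v); exists X.
have [X XE] := fin_all_exists ex.
have [d d_n0 dP] := indicator_relation X HG.
have local (e : edge G) v w x y : val e = [set v; w] -> val (f e) = [set x; y] ->
    d (Some v) * ((x \in X v)%:R - (y \in X v)%:R) +
    d (Some w) * ((x \in X w)%:R - (y \in X w)%:R) = 0.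
  move=> eE feE; have vw : v != w.
    apply: contraTneq (valP e) => vw; rewrite eE vw edge_setP sedge_irrefl //.
  have sum0 : \sum_u d (Some u) * ((x \in X u)%:R - (y \in X u)%:R) = 0.
    under eq_bigr do rewrite mulrBr.
    rewrite sumrB; apply/eqP; rewrite subr_eq0; apply/eqP/(addrI (d None)).
    by rewrite !dP.
  rewrite -[RHS]sum0 (bigD1 v) //= (bigD1 w) 1?eq_sym //= big1 ?addr0 // => u /andP[uv uw].
  have : f e \notin cut (X u) by rewrite -XE (mem_imset _ _ f_inj) inE eE !inE (negPf uv) (negPf uw).
  by rewrite (mem_cut _ feE); case: (x \in X u); case: (y \in X u); rewrite //= subrr mulr0.
have sqE (e : edge G) v w : val e = [set v; w] -> d (Some v) * d (Some v) = d (Some w) * d (Some w).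
  move=> eE; have [x [y [_ feE]]] := edge_ends (f e).
  have := local _ _ _ _ _ eE feE.
  have : f e \in cut (X v) by rewrite -XE (mem_imset _ _ f_inj) inE eE !inE eqxx.
  have : f e \in cut (X w) by rewrite -XE (mem_imset _ _ f_inj) inE eE !inE eqxx orbT.
  rewrite !(mem_cut _ feE).
  have step (a b : F) : a + b = 0 -> a * a = b * b.
    by move=> /eqP; rewrite addr_eq0 => /eqP->; rewrite mulrNN.
  case: (x \in X v); case: (y \in X v); case: (x \in X w); case: (y \in X w) => // _ _;
    rewrite ?subr0 ?sub0r ?mulr1 ?mulrN1 => /step; rewrite ?mulrNN //.
have [v0 v0_n0] : exists v0, d (Some v0) != 0.
  apply/existsP; apply: contraR d_n0; rewrite negb_exists => /forallP d0.
  have d0' v : d (Some v) = 0 by apply/eqP; rewrite -[_ == _]negbK.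
  apply/eqP/ffunP => -[v|]; rewrite ffunE ?d0' //.
  have := dP h0; rewrite big1 ?addr0 // => v _; by rewrite d0' mul0r.
exists X, (fun v => d (Some v) / d (Some v0)); split=> //.
  have sq_const v : d (Some v) * d (Some v) = d (Some v0) * d (Some v0).
    have cl : closed (@sedge G) [pred v | d (Some v) * d (Some v) == d (Some v0) * d (Some v0)].
      by move=> s t /edge_ex[e eE]; rewrite !inE (sqE _ _ _ eE).
    by have := closed_connect cl (G_conn v0 v); rewrite !inE eqxx => /esym/eqP.
  by move=> v; rewrite mulrACA sq_const -mulrACA divff // mulr1.
move=> e v w x y eE feE; have := local _ _ _ _ _ eE feE.
move=> E; rewrite mulrAC [X in _ + X]mulrAC -mulrDl E mul0r //.
Qed.

(** The dart [(v, w)] is sent to the orientation of [f (vw)] that leaves [X v],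
    with the sign [t v]. Kirchhoff's law at [v] is then the vanishing of the
    total flow out of [X v], and antisymmetry is the relation between [t v] and
    [t w]. *)
Lemma sign_lift : exists T : {ffun H * H -> F} -> {ffun G * G -> F},
  (forall z, z \in flows (@sedge H) -> T z \in flows (@sedge G)) /\
  (forall (e : edge G) v w x y, val e = [set v; w] -> val (f e) = [set x; y] ->
     exists2 s : F, s * s = 1 & forall z, z \in flows (@sedge H) -> T z (v, w) = s * z (x, y)).
Proof.
have f_inj := bij_inj f_bij.
have [X [t [XE t2 tX]]] := signed_star_cuts.
pose link (d : G * G) (p : H * H) := [exists e, (val e == [set d.1; d.2]) &&
  (val (f e) == [set p.1; p.2])] && ((p.1 \in X d.1) && (p.2 \notin X d.1)).
pose T (z : {ffun H * H -> F}) : {ffun G * G -> F} :=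
  [ffun d => t d.1 * \sum_(p | link d p) z p].
have f_star (e : edge G) v w x y : val e = [set v; w] -> val (f e) = [set x; y] ->
    (x \in X v) (+) (y \in X v).
  by move=> eE feE; rewrite -(mem_cut _ feE) -XE (mem_imset _ _ f_inj) inE eE !inE eqxx.
have TE (e : edge G) v w x y z : val e = [set v; w] -> val (f e) = [set x; y] -> x \in X v ->
    T z (v, w) = t v * z (x, y).
  move=> eE feE xX; have := f_star _ _ _ _ _ eE feE; rewrite xX /= => yX.
  rewrite ffunE /=; congr (_ * _); rewrite (big_pred1 (x, y)) // => -[a b] /=.
  rewrite /link /=; apply/andP/eqP => [[/existsP[e' /andP[/eqP e'E /eqP fe'E]] /andP[aX bX]]|[-> ->]].
    have ee : e' = e by apply: val_inj; rewrite eE.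
    rewrite ee feE in fe'E; case: (set2_eq fe'E) => -[xE yE]; rewrite xE yE //.
    by rewrite -xE xX in bX.
  by rewrite xX yX; split=> //; apply/existsP; exists e; rewrite eE feE !eqxx.
exists T; split; last first.
  move=> e v w x y eE feE; have := f_star _ _ _ _ _ eE feE.
  have [xX _|xX /= yX] := boolP (x \in X v).
    by exists (t v) => // z _; apply: TE eE feE xX.
  exists (- t v); first by rewrite mulrNN.
  move=> z /flowsP[zN _ _]; rewrite zN mulrNN.
  by apply: TE eE _ yX; rewrite setUC.
move=> z zF; have /flowsP[zN z0 zD] := zF; apply/flowsP; split=> [v w|v w vw|v].
- have [vw|vw] := boolP (sedge v w); last first.
    have T0 a b : ~~ sedge a b -> T z (a, b) = 0.
      move=> ab; rewrite ffunE big1 ?mulr0 // => p /andP[/existsP[e /andP[/eqP eE _]] _].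
      by move: (valP e); rewrite eE edge_setP (negPf ab).
    by rewrite !T0 ?oppr0 // sedge_sym.
  have [e eE] := edge_ex vw.
  have eE' : val e = [set w; v] by rewrite eE setUC.
  have [x [y [feE xX]]] : exists x y, val (f e) = [set x; y] /\ x \in X v.
    have [x [y [_ feE]]] := edge_ends (f e).
    have := f_star _ _ _ _ _ eE feE; have [xX _|_ /= yX] := boolP (x \in X v).
      by exists x, y.
    by exists y, x; rewrite setUC.
  have := f_star _ _ _ _ _ eE feE; rewrite xX /= => yX.
  rewrite (TE _ _ _ _ _ z eE feE xX); have := tX _ _ _ _ _ eE feE.
  have := f_star _ _ _ _ _ eE' feE.
  rewrite xX (negPf yX) subr0 mulr1; have [xXw /= yXw|xXw /= yXw] := boolP (x \in X w).
    rewrite (TE _ _ _ _ _ z eE' feE xXw) (negPf yXw) subr0 mulr1 => /eqP.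
    by rewrite addr_eq0 => /eqP->; rewrite mulNr.
  have feE' : val (f e) = [set y; x] by rewrite setUC.
  rewrite (TE _ _ _ _ _ z eE' feE' yXw) yXw sub0r mulrN1 => /eqP.
  by rewrite subr_eq0 => /eqP->; rewrite zN mulrN.
- rewrite ffunE big1 ?mulr0 // => p /andP[/existsP[e /andP[/eqP eE _]] _].
  by move: (valP e); rewrite eE edge_setP (negPf vw).
under eq_bigr do rewrite ffunE /=.
rewrite -mulr_sumr /= (exchange_big_dep (fun p => (p.1 \in X v) && (p.2 \notin X v))) /=; last first.
  by move=> w p _ /andP[].
rewrite -[X in _ * X](_ : \sum_(p | (p.1 \in X v) && (p.2 \notin X v)) z p = _).
  by rewrite (cut_flow _ zF) mulr0.
apply: eq_bigr => -[x y] /= /andP[xX yX].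
have [xy|xy] := boolP (sedge x y); last by rewrite z0 // big1.
have [g gE] := edge_ex xy.
have : g \in f @: star v by rewrite XE (mem_cut _ gE) xX.
case/imsetP => e ev gfe; have [w eE] := star_ends ev.
rewrite (big_pred1 w) // => w'; rewrite /link /= xX yX !andbT.
apply/existsP/eqP => [[e' /andP[/eqP e'E /eqP fe'E]]|->]; last first.
  by exists e; rewrite -[sval e]/(val e) eE -[sval _]/(val (f e)) -gfe gE !eqxx.
have e'e : e' = e by apply: f_inj; apply: val_inj; rewrite -gfe gE.
have {}e'E : val e' = [set v; w'] := e'E; rewrite e'e eE in e'E; case: (set2_eq e'E) => -[vE wE] //.
by rewrite wE vE.
Qed.
End SignLift.

Lemma signed_pullback_inj (G H : sgraph) (f : edge G -> edge H)
    (T : {ffun H * H -> F} -> {ffun G * G -> F}) :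
  bijective f ->
  (forall (e : edge G) v w x y, val e = [set v; w] -> val (f e) = [set x; y] ->
     exists2 s : F, s * s = 1 & forall z, z \in flows (@sedge H) -> T z (v, w) = s * z (x, y)) ->
  {in flows (@sedge H) &, injective T}.
Proof.
move=> [f' fK f'K] TE z w zF wF eq_T; apply/ffunP => -[x y].
have /flowsP[_ z0 _] := zF; have /flowsP[_ w0 _] := wF.
have [xy|xy] := boolP (sedge x y); last by rewrite z0 ?w0.
have [e eE] := edge_ex xy; have [v [t [_ vtE]]] := edge_ends (f' e).
have [s s2 sE] := TE _ _ _ _ _ vtE (etrans (congr1 val (f'K e)) eE).
by rewrite -[LHS]mul1r -[RHS]mul1r -s2 -!mulrA -!sE // eq_T.
Qed.

Lemma extend_bijection (V W : finType) (A : {set V}) (B : {set W}) (h : V -> W) (w0 : W) :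
  #|V| = #|W| -> {in A &, injective h} -> h @: A = B ->
  exists2 g : V -> W, bijective g &
    {in A, g =1 h} /\ forall x, (g x \in B) = (x \in A).
Proof.
move=> VW h_inj hA.
pose a x := if x \in A then Some (h x) else None.
pose b y := if y \in B then Some y else None.
have [|g g_bij gE] := @fiber_bijection V W (option W) a b w0.
  case=> [w|].
    have [wB|wB] := boolP (w \in B); last first.
      rewrite !eq_card0 // => x; rewrite inE /a /b; case: ifP => // xAB.
        by apply: contraNF wB => /eqP[<-].
      by apply: contraNF wB => /eqP[<-]; rewrite -hA imset_f.
    have := wB; rewrite -hA => /imsetP[v vA wE].
    rewrite (@eq_card1 _ v) ?(@eq_card1 _ w) // => x; rewrite !inE /a /b.
      by case: ifP => xB //; apply/esym; apply: contraFF xB => /eqP->.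
    case: ifP => xA; last by apply/esym; apply: contraFF xA => /eqP->.
    by apply/eqP/eqP => [[]|->]; rewrite ?wE //; apply: h_inj.
  have EA : #|[pred v | a v == None]| = #|~: A|.
    by apply: eq_card => x; rewrite !inE /a; case: (x \in A).
  have EB : #|[pred w | b w == None]| = #|~: B|.
    by apply: eq_card => x; rewrite !inE /b; case: (x \in B).
  by rewrite EA EB [#|~: A|]cardsCs [#|~: B|]cardsCs !setCK -hA card_in_imset // VW.
exists g => //; split=> [x xA|x]; have := gE x; rewrite /a /b.
  by rewrite xA; case: ifP => // _ [].
by case: ifP; case: ifP.
Qed.

(** The vertex bijection matches stars up to series, and flows on edges in series
    agree up to sign; Kirchhoff's law forces the three signs around a vertex to
    be equal. *)
Theorem genus_poly_cycle_matroid_iso (G H : sgraph) :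
  two_connected G -> cubic G -> two_connected H -> cubic H ->
  cycle_matroid_iso G H -> genus_poly G = genus_poly H.
Proof.
move=> G2 G_cubic H2 H_cubic [f f_bij fC].
have [G_conn G_card _] := G2; have [H_conn H_card _] := H2.
have G_bl := two_connected_bridgeless G2 G_cubic.
have H_bl := two_connected_bridgeless H2 H_cubic.
have [g0 _] : exists g0 : G, g0 \in predT by apply/card_gt0P/(leq_trans _ G_card).
have [h0 _] : exists h0 : H, h0 \in predT by apply/card_gt0P/(leq_trans _ H_card).
have f_inj := bij_inj f_bij; have [f' fK f'K] := f_bij.
have fF (D : {set edge G}) : f' @: (f @: D) = D.
  by rewrite -imset_comp (eq_imset _ (fK : f' \o f =1 id)) imset_id.
have f'C (C : {set edge H}) : circuit C <-> circuit (f' @: C).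
  have -> : C = f @: (f' @: C).
    by rewrite -imset_comp (eq_imset _ (f'K : f \o f' =1 id)) imset_id.
  by rewrite fF; split=> /fC.
have f'_bij : bijective f' by exists f.
have f_cut := cycle_matroid_iso_cut H_conn f_bij fC.
have f'_cut := cycle_matroid_iso_cut G_conn f'_bij f'C.
have f_cutE (D : {set edge G}) : is_cut (f @: D) = is_cut D.
  by apply/idP/idP => [/f'_cut|/f_cut]; rewrite ?fF.
have [b b_bij bE] := series_closure_star_bijection f_bij f_cutE G_cubic H_cubic
  G_conn H_conn G_bl H_bl g0 h0.
have cardGH : #|G| = #|H| := bij_eq_card b_bij.
have [T [T_im TE]] := sign_lift f_bij G_conn (eq_leq (esym cardGH)) h0 f_cut.
have [T' [T'_im T'E]] := sign_lift f'_bij H_conn (eq_leq cardGH) g0 f'_cut.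
have T_inj := signed_pullback_inj f_bij TE.
have T'_inj := signed_pullback_inj f'_bij T'E.
have T_onto : T @: flows (@sedge H) = flows (@sedge G).
  apply/eqP; rewrite eqEcard card_in_imset //; apply/andP; split.
    by apply/subsetP => _ /imsetP[z zF ->]; apply: T_im.
  rewrite -(card_in_imset T'_inj); apply: subset_leq_card.
  by apply/subsetP => _ /imsetP[z zF ->]; apply: T'_im.
have match_ex v y : exists y', sedge v y -> sedge (b v) y' /\
    forall e e', val e = [set v; y] -> val e' = [set b v; y'] -> series e' (f e).
  have [vy|_] := boolP (sedge v y); last by exists h0.
  have [e eE] := edge_ex vy.
  have : f e \in series_closure (star (b v)).
    rewrite bE imset_f //; apply: (subsetP (sub_series_closure _)).
    by rewrite inE eE !inE eqxx.
  case/series_closureP => e' e'v e'e; have [y' e'E] := star_ends e'v.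
  exists y' => _; split; first by rewrite -edge_setP -e'E (valP e').
  move=> d d' dE d'E; have -> : d = e by apply: val_inj; rewrite dE.
  by have -> : d' = e' by apply: val_inj; rewrite d'E.
have [h1 h1P] := fin_all_exists (fun v => fin_all_exists (match_ex v)).
have h1_inj v : {in nbrs v &, injective (h1 v)}.
  move=> y y'; rewrite !inE => vy vy' eq_h.
  have [vh S1] := h1P v y vy; have [_ S2] := h1P v y' vy'.
  have [e eE] := edge_ex vy; have [e' e'E] := edge_ex vy'; have [g gE] := edge_ex vh.
  have s1 := S1 _ _ eE gE; have s2 := S2 _ _ e'E (etrans gE (congr1 _ (congr1 _ eq_h))).
  have ee' : series e e'.
    rewrite -(series_iso f_bij f_cutE); apply: series_trans s2.
    by rewrite series_sym.
  have : e = e'.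
    apply: (three_cut_series G_bl (three_cut_star v G_cubic) _ _ ee');
      rewrite inE ?eE ?e'E !inE eqxx //.
  move/(congr1 val); rewrite eE e'E => /set2_eq[[_ //]|[v_y' ->]].
  by rewrite v_y' sedge_irrefl in vy'.
have h1_im v : h1 v @: nbrs v = nbrs (b v).
  apply/eqP; rewrite eqEcard card_in_imset // -!/(deg _) G_cubic H_cubic leqnn andbT.
  apply/subsetP => _ /imsetP[y vy ->]; rewrite inE in vy; rewrite inE.
  by have [] := h1P v y vy.
have h_ex v : exists h : {ffun G -> H}, [/\ bijective h, {in nbrs v, h =1 h1 v}
    & forall y, (h y \in nbrs (b v)) = (y \in nbrs v)].
  have [g g_bij [gh gN]] := extend_bijection h0 cardGH (h1_inj v) (h1_im v).
  exists [ffun x => g x]; split=> [|x xv|y]; [|by rewrite ffunE gh | by rewrite ffunE gN].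
  by apply: (eq_bij g_bij) => x; rewrite ffunE.
have [h hP] := fin_all_exists h_ex.
have hE v y : sedge (b v) (h v y) = sedge v y.
  by have [_ _ /(_ y)] := hP v; rewrite !inE.
have sgn_ex v y : exists s : F, s * s = 1 /\ (sedge v y ->
    forall z, z \in flows (@sedge H) -> T z (v, y) = s * z (b v, h v y)).
  have [vy|_] := boolP (sedge v y); last by exists 1; rewrite mulr1.
  have [e eE] := edge_ex vy; have [x [x' [_ feE]]] := edge_ends (f e).
  have [s s2 sE] := TE _ _ _ _ _ eE feE.
  have := vy; rewrite -hE => /edge_ex[e' e'E].
  have [_ hh _] := hP v; have hy : h v y = h1 v y by rewrite hh // inE.
  have [_ /(_ e e' eE)] := h1P v y vy; rewrite -hy => /(_ e'E) ser.
  rewrite series_sym in ser; have [r r2 rE] := series_flow ser feE e'E.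
  exists (s * r); split; first by rewrite mulrACA s2 r2 mulr1.
  by move=> _ z zF; rewrite sE // rE // mulrA.
have [sgn sgnP] := fin_all_exists (fun v => fin_all_exists (sgn_ex v)).
(* If the other two signs at v are equal, so is the third, by Kirchhoff's law on
   both sides and because some flow does not vanish on the edge. *)
have sgn_odd v y s : sedge v y -> (forall x, sedge v x -> x != y -> sgn v x = s) ->
    sgn v y = s.
  move=> vy others; have by_ : sedge (b v) (h v y) by rewrite hE.
  have [z zF z_n0] := edge_flow H_bl H_conn by_.
  have /flowsP[_ Tz0 TzD] := T_im z zF; have /flowsP[_ z0 zD] := zF.
  have [h_bij _ _] := hP v.
  have sum_z : \sum_x z (b v, h v x) = 0.
    by rewrite -[RHS](zD (b v)) [RHS](reindex (h v)) //; apply: onW_bij.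
  have : \sum_x (T z (v, x) - s * z (b v, h v x)) = 0.
    by rewrite sumrB TzD -mulr_sumr sum_z mulr0 subrr.
  rewrite (bigD1 y) //= big1 ?addr0 => [|x xy].
    have [_ ->] := sgnP v y; rewrite // -mulrBl => /eqP.
    by rewrite mulf_eq0 (negPf z_n0) orbF subr_eq0 => /eqP.
  have [vx|vx] := boolP (sedge v x); last by rewrite Tz0 // z0 ?hE // mulr0 subrr.
  by have [_ ->] := sgnP v x; rewrite // (others x vx xy) subrr.
have sgn_star v y y' : sedge v y -> sedge v y' -> sgn v y = sgn v y'.
  move=> vy vy'; have [->//|ne] := eqVneq y y'.
  have [t tE] : exists t, nbrs v :\ y :\ y' = [set t].
    apply/cards1P; have := cardsD1 y (nbrs v); have := cardsD1 y' (nbrs v :\ y).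
    by rewrite !inE vy vy' eq_sym ne -/(deg v) G_cubic => -> [->].
  have third x : sedge v x -> x != y -> x != y' -> x = t.
    move=> vx xy xy'; apply/eqP; have : x \in nbrs v :\ y :\ y' by rewrite !inE xy xy'.
    by rewrite tE inE.
  have [sy _] := sgnP v y; have [sy' _] := sgnP v y'; have [st _] := sgnP v t.
  have [//|ne_s] := eqVneq (sgn v y) (sgn v y').
  have [ty|ty] : sgn v t = sgn v y \/ sgn v t = sgn v y'.
    have [Ey|Ey] := sign_cases sy; have [Ey'|Ey'] := sign_cases sy';
      have [Et|Et] := sign_cases st; rewrite Ey Ey' ?eqxx ?Et in ne_s *; by [|left|right].
  - apply/esym/sgn_odd => // x vx xy'; have [->//|xy] := eqVneq x y.
    by rewrite (third x).
  - apply: sgn_odd => // x vx xy; have [->//|xy'] := eqVneq x y'.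
    by rewrite (third x).
have nbr (v : G) : exists y, sedge v y.
  have : (0 < #|nbrs v|)%N by rewrite -/(deg v) G_cubic.
  by case/card_gt0P => y; rewrite inE; exists y.
have [n nP] := fin_all_exists nbr.
apply: (@genus_poly_flow_correspondence G H b (fun v => h v) T (fun v => sgn v (n v))) => //.
- by move=> v; have [] := hP v.
- by move=> v; have [] := sgnP v (n v).
move=> z zF v y; have [vy|vy] := boolP (sedge v y).
  by have [_ ->] := sgnP v y; rewrite // (sgn_star v y (n v)).
have /flowsP[_ z0 _] := zF; have /flowsP[_ Tz0 _] := T_im z zF.
by rewrite Tz0 // z0 ?hE // mulr0.
Qed.

Theorem theoremA :
  (forall G H : sgraph,
     two_connected G -> cubic G -> two_connected H -> cubic H ->
     cycle_matroid_iso G H -> genus_poly G = genus_poly H) /\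
  (forall (G : sgraph) (A B : subgraph G) (u v : G),
     two_connected G -> cubic G ->
     whitney_separation A B u v -> balanced_twist A B u v ->
     genus_poly G = genus_poly (whitney_twist A B u v)).
Proof.
split; first exact: genus_poly_cycle_matroid_iso.
by move=> G A B u v [G_conn _ _]; apply: genus_poly_balanced_twist.
Qed.
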